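(* Let $G$ be a group acting by automorphisms on an abelian group $A$, where $G$, $A$ and the action of $G$ on $A$ are $\emptyset$-definable in a first-order structure $\mathcal G$. Let $B\subset\mathcal G$ be a finite parameter set and let $h\colon G\times G\to A$ be a 2-cocycle which is $B$-definable in $\mathcal G$ and has finite image $\mathrm{Im}(h)\subseteq\mathrm{dcl}(B)$. Let $A_0\le A$ be the subgroup generated by $\mathrm{Im}(h)$. Let $\mathcal G^*\succ\mathcal G$ be a monster model, and let $A_1^*$ be a bounded index subgroup of $A^*$ which is type-definable over $B$ and invariant under the action of $G^*$. Let $\widetilde{G}$ be the extension of $G$ by $A$ defined by $h$ and $\widetilde{G^*}$ its interpretation in $\mathcal G^*$. Assume that: (1) there is a $B$-definable subgroup $H$ of $G$ of finite index such that $h_{|H\times H}\colon H\times H\to A$ is split via a $B$-definable function $f\colon H\to A$; (2) $A_0/(A_1^*\cap A_0)$ is torsion free; (3) $\overline{f^*}\left[{G^*}^{00}_B\right]\nsubseteq A_0/A_1^*$, where $\overline{f^*}\colon H^*\to A^*/A_1^*$ is induced by the interpretation $f^*$ of $f$ in $\mathcal G^*$. Then $\widetilde{G^*}^{000}_B\ne\widetilde{G^*}^{00}_B$. Moreover, under (1) and (2), Assumption (3) is satisfied when one (or both) of the following conditions holds: (4) the image $\overline{f^*}\left[{G^*}^{00}_B\right]$ contains a non-trivial subgroup of $A^*/A_1^*$; (5) there is $a\in A\setminus A_1^*$ such that for any $B$-definable thick subset $P$ of $G$ there exists $g\in P\cap H$ such that for every $n\in\mathbb Z$, $f(g^n)=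na$.
   Context: Cocycles. If a group $G$ acts by automorphisms on an abelian group $A$ (written additively), a 2-cocycle is a map $h\colon G\times G\to A$ with $h(g_1,g_2)+h(g_1g_2,g_3)=h(g_1,g_2g_3)+g_1\cdot h(g_2,g_3)$ and $h(g,e)=h(e,g)=0$ for all $g,g_1,g_2,g_3\in G$. It defines the extension $\widetilde G=A\times G$ with product $(a_1,g_1)*(a_2,g_2)=(a_1+g_1\cdot a_2+h(g_1,g_2),\,g_1g_2)$. The restriction $h_{|H\times H}$ is split via $f\colon H\to A$ if $f(e)=0$ and $h(g_1,g_2)=f(g_1)+g_1\cdot f(g_2)-f(g_1g_2)$ for all $g_1,g_2\in H$. Model theory. A monster model $\mathcal G^*\succ\mathcal G$ is a $\kappa$-saturated, strongly $\kappa$-homogeneous elementary extension for a sufficiently large cardinal $\kappa$; ''small'' and ''bounded'' mean of cardinality $<\kappa$. For an object $X$ definable in $\mathcal G$, $X^*$ denotes its interpretation in $\mathcal G^*$. For a group $K$ definable over $B$ in $\mathcal G^*$: $K^{00}_B$ is the smallest subgroup of $K$ of bounded index which is type-definable over $B$, and $K^{000}_B$ is the smallest subgroup of $K$ of bounded index which is invariant under $\mathrm{Aut}(\mathcal G^*/B)$. Since $H^*$ is $B$-definable of finite index, ${G^*}^{00}_B\subseteq H^*$. Notation. $A_0/A_1^*$ denotes $(A_0+A_1^* )/A_1^*\le A^*/A_1^*$. The map $\overline{f^*}$ is $f^*$ followed by the quotient map $A^*\to A^*/A_1^*$. A subset $P$ of a group $G$ is $n$-thick if $P=P^{-1}$ and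 for all $g_1,\dots,g_n\in G$ there are $1\le i<j\le n$ with $g_i^{-1}g_j\in P$; it is thick if it is $n$-thick for some $n\in\mathbb N$. *)

(* Defs.v *)
From HB Require Import structures.
From mathcomp Require Import all_boot all_order all_algebra.
From mathcomp Require Import mathcomp_extra boolp classical_sets functions.
From mathcomp Require Import cardinality.

Set Implicit Arguments.
Unset Strict Implicit.
Unset Printing Implicit Defensive.

Import GRing.Theory.

Local Open Scope classical_set_scope.
Local Open Scope card_scope.

Record language := Language {
  fsym : Type; farity : fsym -> nat;
  rsym : Type; rarity : rsym -> nat }.

Record structure (L : language) := Structure {
  carrier :> Type;
  fint : forall s : fsym L, ('I_(farity s) -> carrier) -> carrier;
  rint : forall s : rsym L, ('I_(rarity s) -> carrier) -> Prop }.

Inductive term (L : language) (V : Type) : Type :=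
| Var (v : V)
| App (s : fsym L) (t : 'I_(farity s) -> term L V).

(* [formula L V]: first-order formulas whose free variables are named by [V];
   the variable bound by [All] is [None]. A formula with free variables
   x_0, ..., x_(n-1) and parameters named by [W] is a [formula L ('I_n + W)]. *)
Inductive formula (L : language) (V : Type) : Type :=
| Bot
| Eqn (t u : term L V)
| Rel (s : rsym L) (t : 'I_(rarity s) -> term L V)
| Imp (phi psi : formula L V)
| All (phi : formula L (option V)).

Section Semantics.
Context (L : language).

Fixpoint eval (M : structure L) (V : Type) (v : V -> M) (t : term L V) : M :=
  match t with
  | Var x => v x
  | App s u => fint (fun i => eval v (u i))
  end.

Fixpoint sat (M : structure L) (V : Type) (phi : formula L V) : (V -> M) -> Prop :=
  match phi with
  | Bot => fun=> False
  | Eqn t u => fun v => eval v t = eval v u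
  | Rel s t => fun v => rint (fun i => eval v (t i))
  | Imp phi psi => fun v => sat phi v -> sat psi v
  | All phi => fun v => forall a : M, sat phi (fun o => odflt a (omap v o))
  end.

Definition elementary_embedding (M N : structure L) (iota : M -> N) : Prop :=
  forall (V : Type) (phi : formula L V) (v : V -> M), sat phi v <-> sat phi (iota \o v).

Definition automorphism (M : structure L) (s : M -> M) : Prop :=
  [/\ bijective s,
      forall (g : fsym L) a, s (fint (s := g) a) = fint (s \o a)
    & forall (r : rsym L) a, rint (s := r) a <-> rint (s := r) (s \o a)].

Definition join (T V W : Type) (v : V -> T) (w : W -> T) : V + W -> T :=
  fun x => match x with inl y => v y | inr z => w z end.

Definition pair_code (T V W X Y : Type) (c : X -> V -> T) (d : Y -> W -> T) :
    X * Y -> V + W -> T :=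
  fun p => join (c p.1) (d p.2).

Section Definability.
(* [c] presents a type [X] as a set of [V]-tuples of [M], and [b] enumerates
   the parameter set. *)
Context (M : structure L) (W : Type) (b : W -> M).

Definition definable (V X : Type) (c : X -> V -> M) (P : set X) : Prop :=
  exists phi : formula L (V + W), forall x, P x <-> sat phi (join (c x) b).

Definition type_definable (V X : Type) (c : X -> V -> M) (P : set X) : Prop :=
  exists Phi : set (formula L (V + W)), forall x,
    P x <-> forall phi, Phi phi -> sat phi (join (c x) b).

Definition aut_invariant (V X : Type) (c : X -> V -> M) (P : set X) : Prop :=
  forall s : M -> M, automorphism s -> s \o b = b ->
  forall x y, c y = s \o c x -> P x -> P y.

Definition dcl : set M :=
  [set a | definable (fun x (_ : unit) => x) [set a]].

End Definability.

(* The cardinal kappa is given by a type having that cardinality. *)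
Definition small (kappa T : Type) (S : set T) : Prop :=
  ~ ([set: kappa] #<= S).

Definition saturated (kappa : Type) (N : structure L) : Prop :=
  forall (C : set N), small kappa C ->
  forall Phi : set (formula L (unit + C)),
    (forall F, finite_set F -> F `<=` Phi -> exists a : N,
       forall phi, F phi -> sat phi (join (fun=> a) (fun x : C => val x))) ->
    exists a : N,
      forall phi, Phi phi -> sat phi (join (fun=> a) (fun x : C => val x)).

Definition strongly_homogeneous (kappa : Type) (N : structure L) : Prop :=
  forall (C : set N), small kappa C ->
  forall f : C -> N,
    (forall phi : formula L C, sat phi (fun x : C => val x) <-> sat phi f) ->
    exists2 s : N -> N, automorphism s & forall x : C, s (val x) = f x.

(* The second condition, kappa > 2 ^ (|L| + |M| + aleph_0), makes precise that
   kappa is sufficiently large: bounded-index subgroups that are type-definable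
   or invariant over parameters in M then have index at most that power. *)
Definition monster (kappa : Type) (M N : structure L) (iota : M -> N) : Prop :=
  [/\ elementary_embedding iota,
      small kappa [set: set (fsym L + rsym L + M + nat)],
      saturated kappa N
    & strongly_homogeneous kappa N].

Section Interpretation.
Context (M N : structure L) (iota : M -> N).

(* [P] is definable in [M] over the parameters [b], and [P'] is its
   interpretation in [N], i.e. it is defined there by the same formula. *)
Definition interpreted (W : Type) (b : W -> M) (V X X' : Type) (c : X -> V -> M)
    (c' : X' -> V -> N) (P : set X) (P' : set X') : Prop :=
  exists phi : formula L (V + W),
    (forall x, P x <-> sat phi (join (c x) b)) /\
    (forall x, P' x <-> sat phi (join (c' x) (iota \o b))).

Definition interpreted0 (V X X' : Type) := @interpreted void (of_void M) V X X'.

(* [X] is (coded as) a 0-definable set of [V]-tuples of [M], and [X'] is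
   its interpretation in [N]. *)
Definition interpreted_type (V X X' : Type) (c : X -> V -> M) (c' : X' -> V -> N) :=
  [/\ injective c, injective c' & interpreted0 id id (range c) (range c')].

(* The inclusion of [X] in its interpretation; [x0] is a dummy value. *)
Definition ext_incl (V X : Type) (X' : choiceType) (x0 : X') (c : X -> V -> M)
    (c' : X' -> V -> N) (x : X) : X' :=
  xget x0 [set y | c' y = iota \o c x].

End Interpretation.

End Semantics.

Definition graph1 (X Y : Type) (D : set X) (f : X -> Y) : set (X * Y) :=
  [set p | D p.1 /\ f p.1 = p.2].
Definition graph2 (X Y Z : Type) (f : X -> Y -> Z) : set (X * Y * Z) :=
  [set p | f p.1.1 p.1.2 = p.2].

(* A group is given here by its operation [op] and unit [e], so that these
   notions also apply to group extensions and to quotients (see [ext_mul] and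
   [quotient_subgroup]). *)
Section Subgroups.
Context (X : Type) (op : X -> X -> X) (e : X).

Definition subgroup (K : set X) : Prop :=
  [/\ K e,
      forall x y, K x -> K y -> K (op x y)
    & forall x, K x -> exists y, [/\ K y, op x y = e & op y x = e]].

Definition lcoset (x : X) (K : set X) : set X := [set op x k | k in K].

Definition lcosets (K : set X) : set (set X) := [set lcoset x K | x in setT].

Definition generated (S : set X) : set X := smallest [set K | subgroup K] S.

Definition bounded_index (kappa : Type) (K : set X) : Prop :=
  small kappa (lcosets K).

Context (L : language) (N : structure L) (V : Type) (c : X -> V -> N).
Context (kappa : Type) (W : Type) (b : W -> N).

(* [smallest] is the intersection of all such subgroups; when kappa is as
   large as in [monster], that intersection is itself such a subgroup. *)
Definition conn00 : set X :=
  smallest [set K | [/\ subgroup K, bounded_index kappa K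
                      & type_definable b c K]] set0.

Definition conn000 : set X :=
  smallest [set K | [/\ subgroup K, bounded_index kappa K
                      & aut_invariant b c K]] set0.

End Subgroups.

Definition thick (G : groupType) (P : set G) : Prop :=
  (forall x, P x <-> P (x^-1)%g) /\
  exists n : nat, forall g : 'I_n -> G,
    exists i j : 'I_n, (i < j)%N /\ P ((g i)^-1 * g j)%g.

Definition expgz (G : groupType) (g : G) (n : int) : G :=
  match n with Posz m => (g ^+ m)%g | Negz m => (g ^- m.+1)%g end.

Section Extension.
Local Open Scope ring_scope.

Definition acts_by_automorphisms (G : groupType) (A : zmodType)
    (act : G -> A -> A) : Prop :=
  [/\ forall a, act 1%g a = a,
      forall g1 g2 a, act (g1 * g2)%g a = act g1 (act g2 a)
    & forall g a1 a2, act g (a1 + a2) = act g a1 + act g a2].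

Definition cocycle2 (G : groupType) (A : zmodType) (act : G -> A -> A)
    (h : G -> G -> A) : Prop :=
  (forall g1 g2 g3,
     h g1 g2 + h (g1 * g2)%g g3 = h g1 (g2 * g3)%g + act g1 (h g2 g3)) /\
  (forall g, h g 1%g = 0 /\ h 1%g g = 0).

Definition ext_mul (G : groupType) (A : zmodType) (act : G -> A -> A)
    (h : G -> G -> A) (x y : A * G) : A * G :=
  (x.1 + act x.2 y.1 + h x.2 y.2, (x.2 * y.2)%g).

Definition ext_one (G : groupType) (A : zmodType) : A * G := (0, 1%g).

Definition split_on (G : groupType) (A : zmodType) (act : G -> A -> A)
    (h : G -> G -> A) (H : set G) (f : G -> A) : Prop :=
  f 1%g = 0 /\
  forall g1 g2, H g1 -> H g2 ->
    h g1 g2 = f g1 + act g1 (f g2) - f (g1 * g2)%g.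

(* Quotients of abelian groups: the elements of A / N are the cosets of N,
   and cosets are added as subsets of A. *)
Section Quotient.
Context (A : zmodType).

Definition qproj (N : set A) (a : A) : set A := lcoset +%R a N.

Definition quotient (D N : set A) : set (set A) := [set qproj N a | a in D].

Definition sumset (S T : set A) : set A := [set a + b | a in S & b in T].

Definition torsion_free_quotient (D N : set A) : Prop :=
  forall a (n : nat), D a -> (0 < n)%N ->
    qproj N (a *+ n) = qproj N 0 -> qproj N a = qproj N 0.

Definition quotient_subgroup (N : set A) (S : set (set A)) : Prop :=
  S `<=` quotient setT N /\ subgroup sumset N S.

End Quotient.
End Extension.

(* Main.v *)
Require Import Defs.
From Stdlib Require List.
From HB Require Import structures.
From mathcomp Require Import all_boot all_order all_algebra.
From mathcomp Require Import mathcomp_extra boolp classical_sets functions.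
From mathcomp Require Import cardinality.

Set Implicit Arguments.
Unset Strict Implicit.
Unset Printing Implicit Defensive.

Import GRing.Theory.

Local Open Scope classical_set_scope.
Local Open Scope ring_scope.

                                                                         
                                                  
                                                                               
                                                                                 
                                                                               
                                                                                 
                                                                                 
                                                                              
                                                                                 
                                                                              
                                                                                
                                                                
                                                                                 
                                            

                                                                        
                                                                           
                                                                              
                                                                             
                                                                                
                                                                           
                                                                                
                                                                              
                                                                                 
                                                                            
                                                                              
                                                                     

                                                                              
                                                                      
                                                                          
                                                                          
                                                                         
                                                                                
                                                                              
                                                                                
                                                                          

Lemma InP (T : eqType) (x : T) s : reflect (List.In x s) (x \in s).
Proof.
elim: s => [|y s IH] /=; first by rewrite in_nil; constructor.
rewrite in_cons; apply: (iffP orP) => [[/eqP->|/IH]|[->|/IH]].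
all: by [left|right|left|right].
Qed.

Lemma In_pmap T U (f : T -> option U) (s : seq T) x y :
  f x = Some y -> List.In x s -> List.In y (pmap f s).
Proof.
move=> fx; elim: s => //= z s IH [->|/IH]; first by rewrite fx /=; left.
by case: (f z) => //= w; right.
Qed.

                                           

Section Renaming.
Context (L : language).

Fixpoint rename_term (V W : Type) (r : V -> W) (t : term L V) : term L W :=
  match t with
  | Var x => Var L (r x)
  | App s u => App (fun i => rename_term r (u i))
  end.

Fixpoint rename_formula (V : Type) (phi : formula L V) : forall W, (V -> W) ->
    formula L W :=
  match phi with
  | Bot => fun W _ => Bot L W
  | Eqn t u => fun W r => Eqn (rename_term r t) (rename_term r u)
  | Rel s t => fun W r => Rel (fun i => rename_term r (t i))
  | Imp p q => fun W r => Imp (rename_formula p r) (rename_formula q r)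
  | All p => fun W r => All (rename_formula p (omap r))
  end.

Lemma eval_rename (M : structure L) V W (r : V -> W) (v : W -> M) t :
  eval v (rename_term r t) = eval (v \o r) t.
Proof. by elim: t => //= s t IH; congr fint; apply: funext => i; exact: IH. Qed.

Lemma sat_rename (M : structure L) V (phi : formula L V) W (r : V -> W) (v : W -> M) :
  sat (rename_formula phi r) v <-> sat phi (v \o r).
Proof.
elim: phi W r v => {V} //= [V t u|V s t|V p IHp q IHq|V p IH] W r v.
- by rewrite !eval_rename.
- suff -> : (fun i => eval v (rename_term r (t i))) = (fun i => eval (v \o r) (t i))
    by [].
  by apply: funext => i; rewrite eval_rename.
- by case: (IHp _ r v) (IHq _ r v) => ? ? [? ?]; split; auto.
- split=> H a.
  + have /IH := H a; congr (sat _ _); apply: funext => -[x|] //.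
  + apply/IH; have := H a; congr (sat _ _); apply: funext => -[x|] //.
Qed.

Lemma eval_aut (M : structure L) (s : M -> M) V (v : V -> M) t :
  automorphism s -> eval (s \o v) t = s (eval v t).
Proof.
by case=> _ sf _; elim: t => //= g t IH; rewrite sf; congr fint; apply: funext.
Qed.

Lemma sat_aut (M : structure L) (s : M -> M) V (phi : formula L V) (v : V -> M) :
  automorphism s -> sat phi v <-> sat phi (s \o v).
Proof.
move=> sA; elim: phi v => {V} //= [V t u|V r t|V p IHp q IHq|V p IH] v.
- rewrite !(eval_aut _ _ sA); split=> [->//|].
  by case: sA => /bij_inj + _ _; apply.
- case: (sA) => _ _ sr; rewrite sr.
  suff -> : s \o (fun i => eval v (t i)) = (fun i => eval (s \o v) (t i)) by [].
  by apply: funext => i; rewrite /= eval_aut.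
- by case: (IHp v) (IHq v) => ? ? [? ?]; split; auto.
- case: (sA) => -[s' sK s'K] _ _; split=> H a.
  + have /IH := H (s' a); congr (sat _ _); apply: funext => -[x|] //=.
  + apply/IH; have := H (s a); congr (sat _ _); apply: funext => -[x|] //=.
Qed.

End Renaming.

                                                           

Section BiDefinability.
Context (L : language) (M N : structure L).

                                                                             
                                                                            
Definition tbidef V (P : set (V -> M)) (P' : set (V -> N)) : Prop :=
  exists phi : formula L V,
    (forall v, P v <-> sat phi v) /\ (forall v, P' v <-> sat phi v).

Lemma tbidef_ren V W (r : V -> W) (P : set (V -> M)) (P' : set (V -> N)) :
  tbidef P P' ->
  tbidef [set v : W -> M | P (v \o r)] [set v : W -> N | P' (v \o r)].
Proof.
case=> phi [H H']; exists (rename_formula phi r); split=> v /=.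
  by rewrite H sat_rename.
by rewrite H' sat_rename.
Qed.

Lemma tbidef_imp V (P Q : set (V -> M)) P' Q' : tbidef P P' -> tbidef Q Q' ->
  tbidef [set v | P v -> Q v] [set v | P' v -> Q' v].
Proof.
move=> [p [Hp Hp']] [q [Hq Hq']]; exists (Imp p q); split=> v /=.
  by rewrite Hp Hq.
by rewrite Hp' Hq'.
Qed.

Lemma tbidef_false V : tbidef (fun _ : V -> M => False) (fun _ : V -> N => False).
Proof. by exists (Bot L V). Qed.

Lemma tbidef_eq V (x y : V) :
  tbidef (fun v : V -> M => v x = v y) (fun v : V -> N => v x = v y).
Proof. by exists (Eqn (Var L x) (Var L y)). Qed.

Definition ocons (T V : Type) (a : T) (v : V -> T) : option V -> T :=
  fun o => odflt a (omap v o).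

Lemma tbidef_all1 V (P : set (option V -> M)) P' : tbidef P P' ->
  tbidef [set v : V -> M | forall a, P (ocons a v)]
    [set v : V -> N | forall a, P' (ocons a v)].
Proof.
case=> p [H H']; exists (All p); split=> v /=; split=> h a.
- by rewrite -H; exact: h.
- by rewrite H; exact: h.
- by rewrite -H'; exact: h.
- by rewrite H'; exact: h.
Qed.

Lemma tbidef_ext V (P Q : set (V -> M)) P' Q' : tbidef P P' ->
  (forall v, Q v <-> P v) -> (forall v, Q' v <-> P' v) -> tbidef Q Q'.
Proof.
case=> p [H H'] E E'; exists p; split=> v; first by rewrite E H.
by rewrite E' H'.
Qed.

                                                                             
                                  
Lemma tbidef_all_ord V n (P : set (V + 'I_n -> M)) P' : tbidef P P' ->
  tbidef [set v : V -> M | forall u, P (join v u)]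
    [set v : V -> N | forall u, P' (join v u)].
Proof.
elim: n P P' => [|n IH] P P' PP'.
  apply: (tbidef_ext (tbidef_ren
    (fun x : V + 'I_0 => match x with inl y => y | inr i => False_rect V
       (notF (ltn_ord i)) end) PP')) => v /=.
    split=> [h|h u].
      suff -> : forall w : V + 'I_0 -> V, (forall y, w (inl y) = y) ->
          v \o w = join v (fun i : 'I_0 => v (w (inr i))) by [].
      by move=> w hw; apply: funext => -[y|i] /=; rewrite ?hw.
    move: h; congr (P _); apply: funext => -[y|[]] //.
  split=> [h|h u].
    suff -> : forall w : V + 'I_0 -> V, (forall y, w (inl y) = y) ->
        v \o w = join v (fun i : 'I_0 => v (w (inr i))) by [].
    by move=> w hw; apply: funext => -[y|i] /=; rewrite ?hw.
  move: h; congr (P' _); apply: funext => -[y|[]] //.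
pose r (x : V + 'I_n.+1) : option (V + 'I_n) :=
  match x with inl y => Some (inl y)
  | inr i => omap inr (unlift ord0 i) end.
have key T (a : T) (v : V -> T) (u : 'I_n -> T) :
    ocons a (join v u) \o r = join v (fun i => ocons a u (unlift ord0 i)).
  by apply: funext => -[y|i] //=; case: unlift.
have inv T (u : 'I_n.+1 -> T) :
    u = (fun i => ocons (u ord0) (u \o lift ord0) (unlift ord0 i)).
  by apply: funext => i; case: unliftP => [j ->|->].
have H1 := IH _ _ (tbidef_all1 (tbidef_ren r PP')).
apply: (tbidef_ext H1) => v /=; split=> h u.
- by move=> a; rewrite key.
- by rewrite (inv _ u) -key.
- by move=> a; rewrite key.
- by rewrite (inv _ u) -key.
Qed.

Lemma tbidef_all V (U : finType) (P : set (V + U -> M)) P' : tbidef P P' ->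
  tbidef [set v : V -> M | forall u, P (join v u)]
    [set v : V -> N | forall u, P' (join v u)].
Proof.
move=> PP'.
pose r (x : V + U) : V + 'I_#|U| :=
  match x with inl y => inl y | inr z => inr (enum_rank z) end.
have key T (v : V -> T) (u : 'I_#|U| -> T) :
    join v u \o r = join v (u \o enum_rank) by apply: funext => -[].
have inv T (u : U -> T) : u = (u \o enum_val) \o enum_rank.
  by apply: funext => z /=; rewrite enum_rankK.
apply: (tbidef_ext (tbidef_all_ord (tbidef_ren r PP'))) => v /=; split=> h u.
- by rewrite key.
- by rewrite (inv _ u) -key.
- by rewrite key.
- by rewrite (inv _ u) -key.
Qed.

                                                   

Section Coded.
Context (W : Type) (b : W -> M) (b' : W -> N).

                                                                            
                                         
Definition bidef (V X X' : Type) (c : X -> V -> M) (c' : X' -> V -> N)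
    (P : set X) (P' : set X') : Prop :=
  exists phi : formula L (V + W),
    (forall x, P x <-> sat phi (join (c x) b)) /\
    (forall x, P' x <-> sat phi (join (c' x) b')).

                                                                              
Definition coded (V X X' : Type) (c : X -> V -> M) (c' : X' -> V -> N) : Prop :=
  [/\ injective c, injective c' & tbidef (range c) (range c')].

Definition bifun (V X X' U Y Y' : Type) (c : X -> V -> M) (c' : X' -> V -> N)
    (d : Y -> U -> M) (d' : Y' -> U -> N) (F : X -> Y) (F' : X' -> Y') : Prop :=
  bidef (pair_code c d) (pair_code c' d') [set p | F p.1 = p.2] [set p | F' p.1 = p.2].

Lemma bidef_of_tbidef V X X' (c : X -> V -> M) (c' : X' -> V -> N) P P' Q Q' :
  tbidef Q Q' -> (forall x, P x <-> Q (join (c x) b)) ->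
  (forall x, P' x <-> Q' (join (c' x) b')) -> bidef c c' P P'.
Proof.
case=> p [H H'] E E'; exists p; split=> x; first by rewrite E H.
by rewrite E' H'.
Qed.

Lemma tbidef_sat V (phi : formula L V) : tbidef (sat phi) (sat phi).
Proof. by exists phi. Qed.

Lemma bidef_ext V X X' (c : X -> V -> M) (c' : X' -> V -> N) P P' Q Q' :
  bidef c c' Q Q' -> (forall x, P x <-> Q x) -> (forall x, P' x <-> Q' x) ->
  bidef c c' P P'.
Proof.
case=> p [H H'] E E'; exists p; split=> x; first by rewrite E H.
by rewrite E' H'.
Qed.

Lemma bidef_imp V X X' (c : X -> V -> M) (c' : X' -> V -> N) P P' Q Q' :
  bidef c c' P P' -> bidef c c' Q Q' ->
  bidef c c' [set x | P x -> Q x] [set x | P' x -> Q' x].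
Proof.
case=> p [Hp Hp'] [q [Hq Hq']]; exists (Imp p q); split=> x /=.
  by rewrite Hp Hq.
by rewrite Hp' Hq'.
Qed.

Lemma bidef_false V X X' (c : X -> V -> M) (c' : X' -> V -> N) :
  bidef c c' (fun=> False) (fun=> False).
Proof. by exists (Bot _ _). Qed.

Lemma bidef_true V X X' (c : X -> V -> M) (c' : X' -> V -> N) :
  bidef c c' (fun=> True) (fun=> True).
Proof.
by apply: (bidef_ext (bidef_imp (bidef_false c c') (bidef_false c c'))) => x /=; split.
Qed.

Lemma bidef_not V X X' (c : X -> V -> M) (c' : X' -> V -> N) P P' :
  bidef c c' P P' -> bidef c c' [set x | ~ P x] [set x | ~ P' x].
Proof. by move=> H; exact: (bidef_imp H (bidef_false c c')). Qed.

Lemma bidef_and V X X' (c : X -> V -> M) (c' : X' -> V -> N) P P' Q Q' :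
  bidef c c' P P' -> bidef c c' Q Q' ->
  bidef c c' [set x | P x /\ Q x] [set x | P' x /\ Q' x].
Proof.
move=> H K; apply: (bidef_ext (bidef_not (bidef_imp H (bidef_not K)))) => x /=.
- by case: (pselect (P x)); case: (pselect (Q x)) => k k'; split; tauto.
- by case: (pselect (P' x)); case: (pselect (Q' x)) => k k'; split; tauto.
Qed.

Lemma bidef_or V X X' (c : X -> V -> M) (c' : X' -> V -> N) P P' Q Q' :
  bidef c c' P P' -> bidef c c' Q Q' ->
  bidef c c' [set x | P x \/ Q x] [set x | P' x \/ Q' x].
Proof.
move=> H K; apply: (bidef_ext (bidef_imp (bidef_not H) K)) => x /=.
- by case: (pselect (P x)) => k; split; tauto.
- by case: (pselect (P' x)) => k; split; tauto.
Qed.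

Lemma bidef_iff V X X' (c : X -> V -> M) (c' : X' -> V -> N) P P' Q Q' :
  bidef c c' P P' -> bidef c c' Q Q' ->
  bidef c c' [set x | P x <-> Q x] [set x | P' x <-> Q' x].
Proof. by move=> H K; apply: (bidef_and (bidef_imp H K) (bidef_imp K H)). Qed.

Lemma bidef_all_in V X X' (c : X -> V -> M) (c' : X' -> V -> N) I (s : seq I)
    (P : I -> set X) (P' : I -> set X') :
  (forall i, bidef c c' (P i) (P' i)) ->
  bidef c c' [set x | forall i, List.In i s -> P i x]
            [set x | forall i, List.In i s -> P' i x].
Proof.
move=> H; elim: s => [|i s IH].
  by apply: (bidef_ext (bidef_true c c')) => x /=; split.
apply: (bidef_ext (bidef_and (H i) IH)) => x /=.
  by split=> [h|[h k] j [<-//|/k//]]; split=> [|j k]; apply: h; [left|right].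
by split=> [h|[h k] j [<-//|/k//]]; split=> [|j k]; apply: h; [left|right].
Qed.

                                                                             
                                  
Lemma bidef_ren V X X' (c : X -> V -> M) (c' : X' -> V -> N)
    U Y Y' (d : Y -> U -> M) (d' : Y' -> U -> N) (k : X -> Y) (k' : X' -> Y')
    (r : U -> V) P P' :
  (forall x, d (k x) = c x \o r) -> (forall x, d' (k' x) = c' x \o r) ->
  bidef d d' P P' -> bidef c c' [set x | P (k x)] [set x | P' (k' x)].
Proof.
move=> E E' [p [H H']].
pose r' (x : U + W) : V + W := match x with inl y => inl (r y) | inr z => inr z end.
exists (rename_formula p r'); split=> x /=.
- rewrite H sat_rename E.
  suff -> : join (c x \o r) b = join (c x) b \o r' by [].
  by apply: funext => -[].
- rewrite H' sat_rename E'.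
  suff -> : join (c' x \o r) b' = join (c' x) b' \o r' by [].
  by apply: funext => -[].
Qed.

Lemma coded_pair V (U : Type) X X' Y Y' (c : X -> V -> M) (c' : X' -> V -> N)
    (d : Y -> U -> M) (d' : Y' -> U -> N) :
  coded c c' -> coded d d' -> coded (pair_code c d) (pair_code c' d').
Proof.
have jinj T Z Z' (e : Z -> V -> T) (e' : Z' -> U -> T) : injective e ->
    injective e' -> injective (pair_code e e').
  move=> ie ie' [x y] [x2 y2] E.
  congr (_, _); [apply: ie|apply: ie']; apply: funext => z.
    by have := congr1 (fun f => f (inl z)) E.
  by have := congr1 (fun f => f (inr z)) E.
have jr T Z Z' (e : Z -> V -> T) (e' : Z' -> U -> T) (v : V + U -> T) :
   range (pair_code e e') v <-> range e (v \o inl) /\ range e' (v \o inr).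
  split=> [[[x y] _ <-]|[[x _ hx] [y _ hy]]].
    by split; [exists x|exists y].
  exists (x, y) => //; rewrite /pair_code /= hx hy.
  by apply: funext => -[].
case=> ic ic' [p [rc rc']] [id' id'' [q [rd rd']]]; split; [exact: jinj..|].
have [k [Hk Hk']] : tbidef
   [set v : V + U -> M | ~ (range c (v \o inl) -> ~ range d (v \o inr))]
   [set v : V + U -> N | ~ (range c' (v \o inl) -> ~ range d' (v \o inr))].
  apply: tbidef_imp; last exact: tbidef_false.
  apply: tbidef_imp; first by apply: tbidef_ren; exists p.
  apply: tbidef_imp; last exact: tbidef_false.
  by apply: tbidef_ren; exists q.
exists k; split=> v.
  rewrite jr -Hk /=; split=> [[h1 h2] /(_ h1)//|h].
  by split; apply: contrapT => h'; apply: h => // /h'.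
rewrite jr -Hk' /=; split=> [[h1 h2] /(_ h1)//|h].
by split; apply: contrapT => h'; apply: h => // /h'.
Qed.

Lemma coded_tuple V : coded (@id (V -> M)) (@id (V -> N)).
Proof.
by split=> //; exists (Imp (Bot L _) (Bot L _)); split=> v /=; split=> // _; exists v.
Qed.

Lemma coded_single :
  coded (fun (x : M) (_ : unit) => x) (fun (x : N) (_ : unit) => x).
Proof.
split; [by move=> x y /(congr1 (fun k => k tt))
       |by move=> x y /(congr1 (fun k => k tt))|].
exists (Imp (Bot L _) (Bot L _)); split=> v /=; split=> // _; exists (v tt) => //;
by apply: funext => -[].
Qed.

Lemma bidef_all V (U : finType) X X' Y Y' (c : X -> V -> M) (c' : X' -> V -> N)
    (d : Y -> U -> M) (d' : Y' -> U -> N) (P : set (X * Y)) P' :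
  coded d d' ->
  bidef (pair_code c d) (pair_code c' d') P P' ->
  bidef c c' [set x | forall y, P (x, y)] [set x | forall y, P' (x, y)].
Proof.
case=> _ _ rd [p [H H']].
pose r (x : V + U + W) : V + W + U :=
  match x with inl (inl v) => inl (inl v) | inl (inr u) => inr u
             | inr w => inl (inr w) end.
have Q : tbidef [set v : V + W + U -> M | range d (v \o inr) -> sat p (v \o r)]
               [set v : V + W + U -> N | range d' (v \o inr) -> sat p (v \o r)].
  apply: tbidef_imp; first exact: (tbidef_ren inr rd).
  exact: (tbidef_ren r (tbidef_sat p)).
have E T (e : V -> T) (e' : U -> T) (bb : W -> T) :
    join (join e bb) e' \o r = join (join e e') bb.
  by apply: funext => -[[]|].
apply: (bidef_of_tbidef (tbidef_all Q)) => x /=; split.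
- by move=> h u [y _ e]; have {e}<- : d y = u by []; rewrite E; apply/(H (x, y)).
- by move=> h y; have := h (d y); rewrite E -(H (x, y)); apply; exists y.
- by move=> h u [y _ e]; have {e}<- : d' y = u by []; rewrite E; apply/(H' (x, y)).
- by move=> h y; have := h (d' y); rewrite E -(H' (x, y)); apply; exists y.
Qed.

Lemma bidef_ex V (U : finType) X X' Y Y' (c : X -> V -> M) (c' : X' -> V -> N)
    (d : Y -> U -> M) (d' : Y' -> U -> N) (P : set (X * Y)) P' :
  coded d d' ->
  bidef (pair_code c d) (pair_code c' d') P P' ->
  bidef c c' [set x | exists y, P (x, y)] [set x | exists y, P' (x, y)].
Proof.
move=> dd' H.
apply: (bidef_ext (bidef_not (bidef_all dd' (bidef_not H)))) => x /=.
- split=> [[y h] /(_ y)//|h]; apply: contrapT => k; apply: h => y h.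
  by apply: k; exists y.
- split=> [[y h] /(_ y)//|h]; apply: contrapT => k; apply: h => y h.
  by apply: k; exists y.
Qed.

Lemma bifun_ren V (U : finType) X X' Y Y' (c : X -> V -> M) (c' : X' -> V -> N)
    (d : Y -> U -> M) (d' : Y' -> U -> N) (k : X -> Y) (k' : X' -> Y')
    (r : U -> V) :
  coded d d' ->
  (forall x, d (k x) = c x \o r) -> (forall x, d' (k' x) = c' x \o r) ->
  bifun c c' d d' k k'.
Proof.
case=> i i' _ E E'.
have Q u : bidef (pair_code c d) (pair_code c' d')
   [set p | c p.1 (r u) = d p.2 u] [set p | c' p.1 (r u) = d' p.2 u].
  by apply: (bidef_of_tbidef (tbidef_eq (inl (inl (r u))) (inl (inr u)))).
have inU u : List.In u (enum U) by apply/InP; rewrite mem_enum.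
apply: (bidef_ext (bidef_all_in (enum U) Q)) => -[x y] /=.
  split=> [<- u _|h]; first by rewrite E.
  by apply: i; apply: funext => u; rewrite E /= h.
split=> [<- u _|h]; first by rewrite E'.
by apply: i'; apply: funext => u; rewrite E' /= h.
Qed.

Lemma bifun_const V (U : finType) X X' Y Y' (c : X -> V -> M) (c' : X' -> V -> N)
    (d : Y -> U -> M) (d' : Y' -> U -> N) (y : Y) (y' : Y')
    (r : U -> W) :
  coded d d' -> d y = b \o r -> d' y' = b' \o r ->
  bifun c c' d d' (fun=> y) (fun=> y').
Proof.
case=> i i' _ E E'.
have Q u : bidef (pair_code c d) (pair_code c' d')
   [set p | b (r u) = d p.2 u] [set p | b' (r u) = d' p.2 u].
  by apply: (bidef_of_tbidef (tbidef_eq (inr (r u)) (inl (inr u)))).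
have inU u : List.In u (enum U) by apply/InP; rewrite mem_enum.
apply: (bidef_ext (bidef_all_in (enum U) Q)) => -[x z] /=.
  split=> [<- u _|h]; first by rewrite E.
  by apply: i; apply: funext => u; rewrite E /= h.
split=> [<- u _|h]; first by rewrite E'.
by apply: i'; apply: funext => u; rewrite E' /= h.
Qed.

                                                                         
Lemma bidef_comp V (U : finType) X X' Y Y' (c : X -> V -> M) (c' : X' -> V -> N)
    (d : Y -> U -> M) (d' : Y' -> U -> N) (F : X -> Y) F' P P' :
  coded d d' -> bifun c c' d d' F F' -> bidef d d' P P' ->
  bidef c c' [set x | P (F x)] [set x | P' (F' x)].
Proof.
move=> dd' dF dP.
have dP2 : bidef (pair_code c d) (pair_code c' d') [set p | P p.2] [set p | P' p.2].
  by apply: (bidef_ren (r := inr) _ _ dP).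
apply: (bidef_ext (bidef_ex dd' (bidef_and dF dP2))) => x /=.
  by split=> [h|[y [<-]]//]; exists (F x).
by split=> [h|[y [<-]]//]; exists (F' x).
Qed.

Lemma bifun_pair V (U1 U2 : finType) X X' Y1 Y1' Y2 Y2'
    (c : X -> V -> M) (c' : X' -> V -> N)
    (d1 : Y1 -> U1 -> M) (d1' : Y1' -> U1 -> N)
    (d2 : Y2 -> U2 -> M) (d2' : Y2' -> U2 -> N)
    (F : X -> Y1) F' (G : X -> Y2) G' :
  bifun c c' d1 d1' F F' -> bifun c c' d2 d2' G G' ->
  bifun c c' (pair_code d1 d2) (pair_code d1' d2')
    (fun x => (F x, G x)) (fun x => (F' x, G' x)).
Proof.
move=> dF dG.
have H1 : bidef (pair_code c (pair_code d1 d2)) (pair_code c' (pair_code d1' d2'))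
   [set p | F p.1 = p.2.1] [set p | F' p.1 = p.2.1].
  apply: (bidef_ren (k := fun p => (p.1, p.2.1)) (k' := fun p => (p.1, p.2.1))
    (r := fun x => match x with inl v => inl v | inr u => inr (inl u) end) _ _ dF)
    => x; apply: funext => -[] //.
have H2 : bidef (pair_code c (pair_code d1 d2)) (pair_code c' (pair_code d1' d2'))
   [set p | G p.1 = p.2.2] [set p | G' p.1 = p.2.2].
  apply: (bidef_ren (k := fun p => (p.1, p.2.2)) (k' := fun p => (p.1, p.2.2))
    (r := fun x => match x with inl v => inl v | inr u => inr (inr u) end) _ _ dG)
    => x; apply: funext => -[] //.
apply: (bidef_ext (bidef_and H1 H2)) => -[x [y z]] /=.
  by split=> [[-> ->]|[-> ->]].
by split=> [[-> ->]|[-> ->]].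
Qed.

Lemma bifun_comp V (U1 U2 : finType) X X' Y Y' Z Z'
    (c : X -> V -> M) (c' : X' -> V -> N)
    (d : Y -> U1 -> M) (d' : Y' -> U1 -> N)
    (e : Z -> U2 -> M) (e' : Z' -> U2 -> N) (F : X -> Y) F' (G : Y -> Z) G' :
  coded d d' -> coded e e' ->
  bifun d d' e e' G G' -> bifun c c' d d' F F' ->
  bifun c c' e e' (fun x => G (F x)) (fun x => G' (F' x)).
Proof.
move=> dd' ee' dG dF.
have dF2 : bifun (pair_code c e) (pair_code c' e') d d'
   (fun p => F p.1) (fun p => F' p.1).
  apply: (bidef_ren (k := fun p => (p.1.1, p.2)) (k' := fun p => (p.1.1, p.2))
    (r := fun x => match x with inl v => inl (inl v) | inr u => inr u end) _ _ dF)
    => x; apply: funext => -[] //.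
have dsnd : bifun (pair_code c e) (pair_code c' e') e e'
   (fun p => p.2) (fun p => p.2).
  by apply: (bifun_ren (r := inr) ee').
exact: (bidef_comp (coded_pair dd' ee') (bifun_pair dF2 dsnd) dG).
Qed.

Lemma bifun_fst V (U : finType) X X' Y Y' (c : Y -> V -> M) (c' : Y' -> V -> N)
  (d : X -> U -> M) (d' : X' -> U -> N) :
  coded d d' -> bifun (pair_code d c) (pair_code d' c') d d' fst fst.
Proof. by move=> dd'; apply: (bifun_ren (r := inl) dd'). Qed.

Lemma bifun_snd V (U : finType) X X' Y Y' (c : Y -> V -> M) (c' : Y' -> V -> N)
  (d : X -> U -> M) (d' : X' -> U -> N) :
  coded d d' -> bifun (pair_code c d) (pair_code c' d') d d' snd snd.
Proof. by move=> dd'; apply: (bifun_ren (r := inr) dd'). Qed.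

Lemma bifun2 V (U1 U2 U3 : finType) X X' Y1 Y1' Y2 Y2' Z Z'
    (c : X -> V -> M) (c' : X' -> V -> N)
    (d1 : Y1 -> U1 -> M) (d1' : Y1' -> U1 -> N)
    (d2 : Y2 -> U2 -> M) (d2' : Y2' -> U2 -> N)
    (e : Z -> U3 -> M) (e' : Z' -> U3 -> N)
    (op : Y1 -> Y2 -> Z) op' (F : X -> Y1) F' (G : X -> Y2) G' :
  coded d1 d1' -> coded d2 d2' -> coded e e' ->
  bifun (pair_code d1 d2) (pair_code d1' d2') e e'
    (fun p => op p.1 p.2) (fun p => op' p.1 p.2) ->
  bifun c c' d1 d1' F F' -> bifun c c' d2 d2' G G' ->
  bifun c c' e e' (fun x => op (F x) (G x)) (fun x => op' (F' x) (G' x)).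
Proof.
move=> o1 o2 o3 dop dF dG.
exact: (bifun_comp (coded_pair o1 o2) o3 dop (bifun_pair dF dG)).
Qed.

Lemma bidef_eq V (U : finType) X X' Y Y' (c : X -> V -> M) (c' : X' -> V -> N)
    (d : Y -> U -> M) (d' : Y' -> U -> N) (F G : X -> Y) F' G' :
  coded d d' -> bifun c c' d d' F F' -> bifun c c' d d' G G' ->
  bidef c c' [set x | F x = G x] [set x | F' x = G' x].
Proof.
move=> dd' dF dG.
have : bifun d d' d d' id id by apply: (bifun_ren (r := id) dd').
exact: (bidef_comp (coded_pair dd' dd') (bifun_pair dF dG)).
Qed.

End Coded.

Lemma bidef_params W (b : W -> M) (b' : W -> N) W2 (b2 : W2 -> M) (b2' : W2 -> N)
   (r : W -> W2) V X X' (c : X -> V -> M) (c' : X' -> V -> N) P P' :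
  b = b2 \o r -> b' = b2' \o r -> bidef b b' c c' P P' -> bidef b2 b2' c c' P P'.
Proof.
move=> -> -> [p [H H']].
pose r' (x : V + W) : V + W2 := match x with inl y => inl y | inr z => inr (r z) end.
exists (rename_formula p r'); split=> x /=.
- rewrite H sat_rename.
  suff -> : join (c x) (b2 \o r) = join (c x) b2 \o r' by [].
  by apply: funext => -[].
- rewrite H' sat_rename.
  suff -> : join (c' x) (b2' \o r) = join (c' x) b2' \o r' by [].
  by apply: funext => -[].
Qed.

End BiDefinability.

Lemma bidef_right (L : language) (M N : structure L) W (b : W -> M) (b' : W -> N)
   V X X' (c : X -> V -> M) (c' : X' -> V -> N) P P' :
  bidef b b' c c' P P' -> bidef b' b' c' c' P' P'.
Proof. by case=> p [_ H]; exists p. Qed.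

Lemma coded_right (L : language) (M N : structure L)
   V X X' (c : X -> V -> M) (c' : X' -> V -> N) :
  coded c c' -> coded c' c'.
Proof. by case=> _ i [p [_ H]]; split=> //; exists p. Qed.

                                               

Section Transfer.
Context (L : language) (M N : structure L) (iota : M -> N).
Hypothesis elem : elementary_embedding iota.

Lemma transfer_at W (b : W -> M) V X X' (c : X -> V -> M) (c' : X' -> V -> N)
    P P' x x' :
  bidef b (iota \o b) c c' P P' -> c' x' = iota \o c x -> P x <-> P' x'.
Proof.
case=> p [H H'] E; rewrite H H' elem E.
suff -> : iota \o join (c x) b = join (iota \o c x) (iota \o b) by [].
by apply: funext => -[].
Qed.

                                                                         
                                               
Lemma transfer_all W (b : W -> M) (V : finType) X X' (c : X -> V -> M) (c' : X' -> V
    -> N)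
    P P' :
  coded c c' -> bidef b (iota \o b) c c' P P' -> (forall x, P x) -> forall x, P' x.
Proof.
move=> cc' H h x'.
pose u (_ : unit) (i : 'I_0) : M := False_rect M (notF (ltn_ord i)).
pose u' (_ : unit) (i : 'I_0) : N := False_rect N (notF (ltn_ord i)).
have H2 : bidef b (iota \o b) (pair_code u c) (pair_code u' c')
    [set p | P p.2] [set p | P' p.2].
  by apply: (bidef_ren (r := inr) _ _ H).
have H3 := bidef_all cc' H2.
have /(transfer_at H3) : u' tt = iota \o u tt by apply: funext => -[].
by case=> + _ => k; exact: (k h).
Qed.

End Transfer.

                   

Lemma card_le_inj T U (A : set T) (B : set U) (f : T -> U) :
  (forall x, A x -> B (f x)) -> (forall x y, A x -> A y -> f x = f y -> x = y) ->
  (A #<= B)%card.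
Proof.
move=> fAB finj; have fI : {in A &, injective f}.
  by move=> x y /set_mem Ax /set_mem Ay; exact: finj.
rewrite -(card_le_eql (inj_card_eq fI)).
by apply: subset_card_le => _ [x Ax <-]; exact: fAB.
Qed.

                                                                            
                                                                                
                                                                      
Lemma infinite_setX_nat T (S : set T) : infinite_set S ->
  (S `*` [set: nat] #<= S)%card.
Proof.
move=> Sinf.
pose P (F : set (nat -> T)) := (forall f, F f -> injective f /\ range f `<=` S) /\
  (forall f g m n, F f -> F g -> f m = g n -> f = g).
have [F [[Fi Fd] Fmax]] : exists F, P F /\ forall B, F `<` B -> ~ P B.
  apply: Zorn_bigcup => K KP Ktot; split=> [f [X KX Xf]|f g m n [X KX Xf] [Y KY Yg]].
    by case: (KP _ KX) => + _; apply.
  case: (Ktot _ _ KX KY) => [XY|YX].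
    by case: (KP _ KY) => _; apply => //; exact: XY.
  by case: (KP _ KX) => _; apply => //; exact: YX.
pose R := [set x | S x /\ forall f n, F f -> f n <> x].
have Rfin : finite_set R.
  apply: contrapT => /infiniteP /card_leP [f0].
  pose f n : T := val (f0 (to_setT n)).
  have fR n : R (f n) by exact/set_mem/valP.
  have fI : injective f.
    move=> m n /val_inj E; have /(congr1 val) // : to_setT m = to_setT n.
    by apply: inj E; rewrite in_setT.
  apply: (Fmax (F `|` [set f])).
    split=> [h /=|]; first by left.
    move=> /(_ f (or_intror erefl)) Ff.
    by case: (fR 0%N) => _ /(_ f 0%N Ff).
  split=> [g [/Fi//|->]|g h m n [Fg|->] [Fh|->]].
  - by split=> // _ [n _ <-]; case: (fR n).
  - exact: Fd.
  - by move=> E; case: (fR n) => _ /(_ g m Fg E).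
  - by move=> E; case: (fR m) => _ /(_ h n Fh (esym E)).
  - by [].
have [f0 Ff0] : exists f, F f.
  apply: contrapT => F0; apply: Sinf; apply: sub_finite_set Rfin => x Sx.
  by split=> // f n Ff _; apply: F0; exists f.
have [g gI] : exists g : T -> nat, {in R &, injective g}.
  by apply/countable_injP; exact: finite_set_countable.
have codeP x : exists p : (nat -> T) * nat, S x -> F p.1 /\
    ((exists2 n, p.1 n = x & p.2 = n.*2) \/
     [/\ R x, p.1 = f0 & p.2 = (g x).*2.+1]).
  case: (pselect (exists f n, F f /\ f n = x)) => [[f [n [Ff E]]]|nE].
    by exists (f, n.*2) => _; split=> //; left; exists n.
  exists (f0, (g x).*2.+1) => Sx; split=> //; right; split=> //; split=> // f n Ff E.
  by apply: nE; exists f, n.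
                                                                              
                
case: (choice codeP) => code {}codeP.
have codeI x y : S x -> S y -> code x = code y -> x = y.
  move=> /codeP[_ Cx] /codeP[_ Cy] E; rewrite -E in Cy.
  case: Cx => [[n Ex e]|[Rx _ e]]; case: Cy => [[m Ey e']|[Ry _ e']].
  - by rewrite -Ex -Ey; move: e'; rewrite e => /double_inj ->.
  - by move: e'; rewrite e => /(congr1 odd) /=; rewrite !odd_double.
  - by move: e'; rewrite e => /(congr1 odd) /=; rewrite !odd_double.
  - by move: e'; rewrite e => -[] /double_inj; apply: gI; apply/mem_set.
apply: (@card_le_inj _ _ _ _ (fun p => (code p.1).1 (pickle ((code p.1).2, p.2)))).
  by move=> [x n] [/= /codeP[/Fi[_ h] _] _]; apply: h; exists (pickle ((code x).2, n)).
move=> [x n] [y m] [/= Sx _] [/= Sy _] E.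
have [Fx _] := codeP _ Sx; have [Fy _] := codeP _ Sy.
have Ef := Fd _ _ _ _ Fx Fy E.
move: E; rewrite -Ef; case: (Fi _ Fx) => fI _ /fI /(pcan_inj pickleK) [E <-].
by congr (_, _); apply: codeI => //; rewrite [LHS]surjective_pairing
    [RHS]surjective_pairing Ef E.
Qed.

Section Small.
Context (kappa : Type).

Lemma small_le T U (A : set T) (B : set U) :
  (A #<= B)%card -> small kappa B -> small kappa A.
Proof. by move=> AB sB sA; apply: sB; exact: card_le_trans AB. Qed.

Lemma small_image T U (f : T -> U) A : small kappa A -> small kappa (f @` A).
Proof. by move=> sA; apply: (small_le _ sA); exact: card_image_le. Qed.

Hypothesis small_nat : small kappa [set: nat].

Lemma small_countable T (f : nat -> T) A : A `<=` range f -> small kappa A.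
Proof.
move=> Af; apply: small_le _ (small_image (f := f) small_nat).
exact: subset_card_le.
Qed.

Lemma small_setX_nat T (S : set T) : small kappa S -> small kappa (S `*` [set: nat]).
Proof.
move=> sS; case: (pselect (finite_set S)) => [fS|iS].
  apply: small_le _ small_nat; apply: countableX; first exact: finite_set_countable.
  exact: countableP.
exact: small_le (infinite_setX_nat iS) sS.
Qed.

Lemma small_setU_countable T (S A : set T) (f : nat -> T) :
  small kappa S -> A `<=` S `|` range f -> small kappa A.
Proof.
move=> sS ASf; case: (pselect (exists s, S s)) => [[s Ss]|S0]; last first.
  by apply: (small_countable (f := f)) => x /ASf [Sx|//]; case: S0; exists x.
pose F (p : T * nat) := if p.2 is n.+1 then f n else p.1.
have := small_image (f := F) (small_setX_nat sS); apply: small_le.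
apply: subset_card_le => x /ASf [Sx|[n _ <-]]; first by exists (x, 0%N).
by exists (s, n.+1).
Qed.

End Small.

Lemma small_setU_range (kappa T : Type) (U : countType) (S A : set T) (v : U -> T) :
  small kappa [set: nat] -> small kappa S -> A `<=` S `|` range v -> small kappa A.
Proof.
move=> sn sS ASv; case: (pselect (exists u : U, True)) => [[u0 _]|nU]; last first.
  apply: small_le _ sS; apply: subset_card_le => x /ASv [//|[u _ _]].
  by case: nU; exists u.
apply: (small_setU_countable sn sS (f := fun n => v (odflt u0 (unpickle n)))).
move=> x /ASv [|[u _ <-]]; [by left|right].
by exists (pickle u) => //; rewrite pickleK.
Qed.

                                                                               
Lemma small_nat_nat_of (kappa T : Type) : small kappa [set: set (T + nat)] ->
  small kappa [set: nat -> nat].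
Proof.
apply: small_le.
apply: (@card_le_inj _ _ _ _ (fun (f : nat -> nat) (x : T + nat) =>
  exists n, x = inr (pickle (n, f n)))) => // f g _ _ E.
apply: funext => n.
have : exists m, inr (pickle (n, f n)) = inr (pickle (m, g m)) :> T + nat.
  by rewrite -[exists m, _]/((fun x : T + nat => exists m, x = inr (pickle (m, g m)))
      _) -E; exists n.
by case=> m [] /(pcan_inj pickleK) [-> ->].
Qed.

                                         

Section Compactness.
Context (L : language) (N : structure L) (kappa : Type).
Hypothesis small_nat : small kappa [set: nat].
Hypothesis satN : saturated kappa N.

Definition definable_over (C : set N) (V X : Type) (c : X -> V -> N) (P : set X) :=
  bidef (fun x : C => val x) (fun x : C => val x) c c P P.

Lemma definable_over_sub (C C' : set N) (V X : Type) (c : X -> V -> N) P :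
  C `<=` C' -> definable_over C c P -> definable_over C' c P.
Proof.
move=> CC'.
pose r (x : C) : C' := exist _ (val x) (mem_set (CC' _ (set_mem (valP x)))).
by apply: (@bidef_params _ _ _ _ _ _ _ _ _ r); apply: funext.
Qed.

                                                                        
Lemma saturation1 C I (D : I -> set N) : small kappa C ->
  (forall i, definable_over C (fun x (_ : unit) => x) (D i)) ->
  (forall s : seq I, exists a, forall i, List.In i s -> D i a) ->
  exists a, forall i, D i a.
Proof.
move=> sC dD fip.
pose Phi := [set phi : formula L (unit + C) |
  exists i, forall a, D i a <-> sat phi (join (fun=> a) (fun x : C => val x))].
have [|a Ha] := satN sC (Phi := Phi).
  move=> F Ff FPhi.
  have [s Es] : exists s : seq {classic (formula L (unit + C))}, F = [set` s].
    exact/(@finite_seqP {classic (formula L (unit + C))}).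
  have [t Ht] : exists t : seq I, forall phi, F phi -> exists2 i, List.In i t &
     forall a, D i a <-> sat phi (join (fun=> a) (fun x : C => val x)).
    rewrite {}Es {Ff} in FPhi *.
    elim: s FPhi => [|phi s IH] FPhi; first by exists [::].
    have [|t Ht] := IH; first move=> phi' /= h.
      by apply: FPhi => /=; rewrite inE h orbT.
    have [|i Hi] := FPhi phi; first by rewrite /= inE eqxx.
    exists (i :: t) => psi /=; rewrite inE => /orP[/eqP->|/Ht[j tj Hj]].
      by exists i => //; left.
    by exists j => //; right.
  have [a Ha] := fip t; exists a => phi /Ht [i it <-]; exact: Ha.
exists a => i; have [phi [Hphi _]] := dD i; apply/Hphi; apply: Ha.
by exists i.
Qed.

                                                                          
                                                                           
                                                           
Lemma saturation_ord n I : forall C (D : I -> set ('I_n -> N)), small kappa C ->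
  (forall i, definable_over C id (D i)) ->
  (forall s : seq I, exists v, forall i, List.In i s -> D i v) ->
  exists v, forall i, D i v.
Proof.
elim: n => [|n IH] C D sC dD fip.
  have [v _] := fip [::]; exists v => i; have [w /(_ i (or_introl erefl))] := fip [::
      i].
  by congr (D i _); apply: funext => -[].
pose co (a : N) (v : 'I_n -> N) (i : 'I_n.+1) : N := oapp v a (unlift ord0 i).
have coE v : v = co (v ord0) (v \o lift ord0).
  by apply: funext => i; rewrite /co; case: unliftP => [j ->|->].
pose c1 (x : N) (_ : unit) := x.
have ok_id := @coded_tuple L N N 'I_n.
have dco i : definable_over C (pair_code c1 id) [set p | D i (co p.1 p.2)].
  pose r (k : 'I_n.+1) : unit + 'I_n := oapp inr (inl tt) (unlift ord0 k).
  apply: (bidef_ren (r := r) _ _ (dD i)) => -[a v]; apply: funext => k /=;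
    by rewrite /co /r /=; case: unlift.
have [a Ha] : exists a, forall s : seq I, exists v, forall i, List.In i s -> D i (co
    a v).
  apply: (saturation1 sC) => [s|ss].
    exact: (bidef_ex ok_id (bidef_all_in s dco)).
  have [v Hv] := fip (List.concat ss).
  exists (v ord0) => s sss; exists (v \o lift ord0) => i si; rewrite -coE; apply: Hv.
  by apply/List.in_concat; exists s.
have [|i|v Hv] := IH (C `|` [set a]) (fun i => [set v | D i (co a v)]) _ _ Ha.
- by apply: (small_setU_countable small_nat (f := fun=> a) sC) => x [|->];
    [left|right; exists 0%N].
- have sub : C `<=` C `|` [set a] by left.
  have aC : (C `|` [set a]) a by right.
  have ok1 : coded c1 c1 := @coded_single L N N.
  pose r (_ : unit) : (C `|` [set a]) := exist _ a (mem_set aC).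
  have cst := @bifun_const _ _ _ _ (fun x : (C `|` [set a]) => val x) (fun x => val x)
    _ _ _ _ _ _ (@id ('I_n -> N)) (@id ('I_n -> N)) c1 c1 a a r ok1 erefl erefl.
  have did : bifun (fun x : (C `|` [set a]) => val x) (fun x => val x) (@id ('I_n ->
      N)) id id id id id.
    by apply: (bifun_ren (r := id) _ _ ok_id).
  exact: (bidef_comp (coded_pair ok1 ok_id) (bifun_pair cst did) (definable_over_sub
      sub (dco i))).
- by exists (co a v).
Qed.

                                                                           
                       
Lemma compactness (V : finType) X (c : X -> V -> N) C I (D : I -> set X) :
  coded c c -> small kappa C -> (forall i, definable_over C c (D i)) ->
  (forall s : seq I, exists x, forall i, List.In i s -> D i x) ->
  exists x, forall i, D i x.
Proof.
move=> [ic _ [rho [Hrho _]]] sC dD fip.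
pose E (o : option I) := [set v : 'I_#|V| -> N |
  exists2 x, c x = v \o enum_rank & if o is Some i then D i x else True].
have [||v Hv] := @saturation_ord #|V| _ C E sC.
- move=> o.
  have [phi Hphi] : exists phi : formula L (V + C), forall x,
      (if o is Some i then D i x else True) <-> sat phi (join (c x) (fun x : C => val
          x)).
    case: o => [i|]; first by have [phi [H _]] := dD i; exists phi.
    by exists (Imp (Bot L _) (Bot L _)) => x /=; split.
  pose r1 (x : V) : 'I_#|V| + C := inl (enum_rank x).
  pose r2 (x : V + C) : 'I_#|V| + C :=
    match x with inl y => inl (enum_rank y) | inr z => inr z end.
  pose psi : formula L ('I_#|V| + C) :=
    Imp (Imp (rename_formula rho r1) (Imp (rename_formula phi r2) (Bot L _))) (Bot L _).
  have key v : E o v <-> sat psi (join v (fun x : C => val x)).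
    rewrite /psi /= !sat_rename.
    have -> : join v (fun x : C => val x) \o r1 = v \o enum_rank by apply: funext.
    have -> : join v (fun x : C => val x) \o r2 = join (v \o enum_rank) (fun x : C =>
        val x).
      by apply: funext => -[].
    rewrite -Hrho; split=> [[x <- Hx]|h].
      by apply; [exists x|apply/Hphi].
    apply: contrapT => k; apply: h => -[x _ Ex] h; apply: k; exists x => //.
    by apply/Hphi; rewrite Ex.
  by exists psi.
- move=> s.
  have [x Hx] := fip (pmap id s).
  exists (c x \o enum_val) => o os; exists x.
    by apply: funext => z /=; rewrite enum_rankK.
  case: o os => // i; move=> os; apply: Hx.
  elim: s os => //= -[j|] s IH /=; last by case=> // /IH.
  by case=> [[->]|/IH]; [left|right].
- have [x Ex _] := Hv None; exists x => i; have [y Ey Dy] := Hv (Some i).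
  by rewrite (ic x y) // Ex Ey.
Qed.

                                                                              
Lemma compactness_in (V : finType) X (c : X -> V -> N) C I (D : I -> set X) (E : set
    X) :
  coded c c -> small kappa C -> definable_over C c E -> (forall i, definable_over C c
      (D i)) ->
  (forall s : seq I, exists2 x, E x & forall i, List.In i s -> D i x) ->
  exists2 x, E x & forall i, D i x.
Proof.
move=> cc sC dE dD fip; pose F o := if o is Some i then D i else E.
have [o|s|x Hx] := compactness cc sC (D := F).
- by case: o => [i|]; [exact: dD|].
- have [x Ex Dx] := fip (pmap id s); exists x => -[i|] //= si.
  by apply: Dx; exact: (In_pmap (x := Some i)).
- by exists x => [|i]; [exact: (Hx None)|exact: (Hx (Some i))].
Qed.

End Compactness.

                            

Section TypeDefinable.
Context (L : language) (N : structure L).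

Definition type_definable_over (C : set N) (V X : Type) (c : X -> V -> N) (P : set X) :=
  exists I (D : I -> set X), (forall i, definable_over C c (D i)) /\
    forall x, P x <-> forall i, D i x.

Definition definable_fun_over (C : set N) (V X U Y : Type) (c : X -> V -> N) (d : Y
    -> U -> N)
    (F : X -> Y) := bifun (fun x : C => val x) (fun x : C => val x) c c d d F F.

Lemma definable_overP W (b : W -> N) (V X : Type) (c : X -> V -> N) (P : set X) :
  definable_over (range b) c P <-> definable b c P.
Proof.
split.
  have /choice [r rP] : forall x : range b, exists w, b w = val x.
    by move=> x; have [w _ <-] := set_mem (valP x); exists w.
  have rE : (fun x : range b => val x) = b \o r by apply: funext => x /=; rewrite rP.
  by move=> /(bidef_params rE rE) [phi [H _]]; exists phi.
pose r w : range b := exist _ (b w) (mem_set (ex_intro2 _ _ w I erefl)).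
have rE : b = (fun x : range b => val x) \o r by [].
case=> phi H; apply: (bidef_params rE rE).
by exists phi.
Qed.

Lemma type_definable_overP W (b : W -> N) (V X : Type) (c : X -> V -> N) (P : set X) :
  type_definable_over (range b) c P <-> type_definable b c P.
Proof.
split=> [[I [D [dD E]]]|[Phi E]].
  exists [set phi | exists i, forall x, D i x <-> sat phi (join (c x) b)] => x.
  rewrite E; split=> [h phi [i Hi]|h i]; first by apply/Hi; exact: h.
  have /definable_overP [phi Hphi] := dD i; apply/Hphi; apply: h.
  by exists i.
exists (sig Phi), (fun phi => [set x | sat (sval phi) (join (c x) b)]); split.
  by move=> phi; apply/definable_overP; exists (sval phi).
move=> x; rewrite E; split=> [h [phi Hphi]|h phi Hphi]; first exact: h.
exact: (h (exist _ phi Hphi)).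
Qed.

Lemma type_definable_over_sub (C1 C2 : set N) (V X : Type) (c : X -> V -> N) P :
  C1 `<=` C2 -> type_definable_over C1 c P -> type_definable_over C2 c P.
Proof.
move=> CC [I [D [dD HD]]]; exists I, D; split=> // i; exact: definable_over_sub (dD i).
Qed.

Lemma type_definable_over_setT C (V X : Type) (c : X -> V -> N) : type_definable_over
    C c setT.
Proof. by exists void, (fun=> setT); split=> [[]|x]; split. Qed.

Lemma type_definable_over_definable C (V X : Type) (c : X -> V -> N) P :
    definable_over C c P -> type_definable_over C c P.
Proof. by exists unit, (fun=> P); split=> // x; split=> [|/(_ tt)]. Qed.

Lemma type_definable_over_setI C (V X : Type) (c : X -> V -> N) P Q :
  type_definable_over C c P -> type_definable_over C c Q -> type_definable_over C c
      (P `&` Q).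
Proof.
move=> [I [D [dD HP]]] [J [E [dE HQ]]].
exists (I + J)%type, (fun k => match k with inl i => D i | inr j => E j end).
split=> [[i|j]//|x]; split=> [[/HP h /HQ k] [i|j]|h]; [exact: h|exact: k|].
by split; [apply/HP => i; exact: (h (inl i))|apply/HQ => j; exact: (h (inr j))].
Qed.

Lemma type_definable_over_bigcap C (V X : Type) (c : X -> V -> N) I (P : I -> set X) :
  (forall i, type_definable_over C c (P i)) -> type_definable_over C c [set x |
      forall i, P i x].
Proof.
move=> H.
exists {D : set X | definable_over C c D /\ exists i, P i `<=` D}, sval; split=> [[D
    []]//|x /=].
split=> [h [D [dD [i PiD]]]|h i]; first exact/PiD/h.
have [J [E [dE HE]]] := H i; apply/HE => j.
have k : definable_over C c (E j) /\ exists i, P i `<=` E j.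
  by split=> //; exists i => y /HE.
exact: (h (exist _ _ k)).
Qed.

Lemma type_definable_over_comp C V (U : finType) X Y (c : X -> V -> N) (d : Y -> U ->
    N) F P :
  coded d d -> definable_fun_over C c d F -> type_definable_over C d P ->
      type_definable_over C c [set x | P (F x)].
Proof.
move=> cd dF [I [D [dD HP]]].
exists I, (fun i => [set x | D i (F x)]); split=> [i|x] /=; last by rewrite HP.
exact: (bidef_comp cd dF (dD i)).
Qed.

Lemma definable_fun_over_const (C : set N) V (U : finType) X Y (c : X -> V -> N) (d :
    Y -> U -> N) y :
  coded d d -> (forall u, C (d y u)) -> definable_fun_over C c d (fun=> y).
Proof.
move=> cd Cy; pose r u : C := exist _ (d y u) (mem_set (Cy u)).
exact: (@bifun_const _ _ _ _ _ _ _ _ _ _ _ _ _ _ _ _ _ _ r).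
Qed.

Section Image.
Context (kappa : Type).
Hypothesis small_nat : small kappa [set: nat].
Hypothesis satN : saturated kappa N.

                                                                            
                                                                                
                
Lemma type_definable_over_image C (V U : finType) X Y (c : X -> V -> N) (d : Y -> U
    -> N) F P :
  small kappa C -> coded c c -> coded d d -> definable_fun_over C c d F ->
      type_definable_over C c P ->
  type_definable_over C d (F @` P).
Proof.
move=> sC cc cd dF [I [D [dD HP]]].
pose E (s : seq I) := [set y | exists x, (forall i, List.In i s -> D i x) /\ F x = y].
exists (seq I), E; split=> [s|y].
  apply: (bidef_ex cc (P := [set p | (forall i, List.In i s -> D i p.2) /\ F p.2 = p.1])
    (P' := [set p | (forall i, List.In i s -> D i p.2) /\ F p.2 = p.1])).
  apply: bidef_and.
    apply: bidef_all_in => i.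
    by apply: (bidef_ren (r := inr) _ _ (dD i)).
  pose r (x : V + U) : U + V := match x with inl v => inr v | inr u => inl u end.
  apply: (bidef_ren (r := r) (k := fun p => (p.2, p.1)) (k' := fun p => (p.2, p.1)) _
      _ dF).
    by move=> p; apply: funext => -[].
  by move=> p; apply: funext => -[].
split=> [[x /HP Px <-] s|h]; first by exists x.
pose C' := C `|` range (d y).
have sC' : small kappa C' by exact: (small_setU_range small_nat sC (v := d y)).
have CC' : C `<=` C' by left.
have dF' : definable_fun_over C' c d F := definable_over_sub CC' dF.
have dy : definable_fun_over C' c d (fun=> y) by apply: definable_fun_over_const =>
    // u; right; exists u.
have [i|s|x Fx Dx] := compactness_in small_nat satN cc sC' (bidef_eq cd dF' dy) (D :=
    D).
- exact: definable_over_sub (dD i).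
- by have [x [Dx Fx]] := h s; exists x.
- by exists x => //; apply/HP.
Qed.

End Image.
End TypeDefinable.

                                            

Section GroupLaw.
Context (X : Type) (op : X -> X -> X) (e : X) (inv : X -> X).

                                                                               
                                          
Definition group_law := [/\ associative op, left_id e op, right_id e op,
  left_inverse e inv op & right_inverse e inv op].

Hypothesis gX : group_law.

Definition ldiv x y := op (inv x) y.

Lemma ldivP x y z : ldiv x y = z <-> op x z = y.
Proof.
case: gX => a l r vl vr; split=> <-; first by rewrite /ldiv a vr l.
by rewrite /ldiv a vl l.
Qed.

Lemma ldiv_ldiv r x y : ldiv (ldiv r x) (ldiv r y) = ldiv x y.
Proof.
case: gX => a l r' vl vr; apply/ldivP.
by rewrite /ldiv -a (a x) vr l.
Qed.

Lemma subgroup_ldivP K : subgroup op e K <->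
  K e /\ forall x y, K x -> K y -> K (ldiv x y).
Proof.
case: (gX) => a l r vl vr; split=> [[K1 KM KV]|[K1 Kd]].
  split=> // x y Kx Ky; have [x' [Kx' xx' _]] := KV x Kx.
  suff -> : ldiv x y = op x' y by exact: KM.
  by apply/ldivP; rewrite a xx' l.
have KV x : K x -> K (inv x) by move=> Kx; rewrite -[inv x]r; exact: Kd.
split=> // [x y Kx Ky|x Kx]; last by exists (inv x); split; [exact: KV|..].
suff -> : op x y = ldiv (inv x) y by apply: Kd => //; exact: KV.
by apply/esym/ldivP; rewrite a vl l.
Qed.

                                                                           
                                                           
Lemma subgroup_cancelP K : subgroup op e K <->
  K e /\ forall x z, K x -> K (op x z) -> K z.
Proof.
rewrite subgroup_ldivP; split=> -[K1 H]; split=> // x y Kx Ky.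
  suff <- : ldiv x (op x y) = y by exact: H.
  exact/ldivP.
by apply: (H x) => //; rewrite ((ldivP _ _ _).1 erefl).
Qed.

Lemma subgroupI K K' : subgroup op e K -> subgroup op e K' -> subgroup op e (K `&` K').
Proof.
move=> /subgroup_ldivP [h1 hd] /subgroup_ldivP [k1 kd]; apply/subgroup_ldivP.
by split=> // x y [? ?] [? ?]; split; [exact: hd|exact: kd].
Qed.

Lemma subgroupT : subgroup op e setT.
Proof. exact/subgroup_ldivP. Qed.

Lemma lcoset_eqP K x y : subgroup op e K ->
  lcoset op x K = lcoset op y K <-> K (ldiv x y).
Proof.
case: (gX) => a l r vl vr sK; have [K1 KM KV] := sK.
have /subgroup_ldivP [_ Kd] := sK; split=> [E|Kxy].
  have : lcoset op x K y by rewrite E; exists e.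
  by case=> k Kk <-; rewrite /ldiv a vl l.
have E : y = op x (ldiv x y) by exact/esym/ldivP.
apply/seteqP; split=> _ [k Kk <-]; last first.
  by exists (op (ldiv x y) k); [exact: KM|rewrite a -E].
exists (ldiv (ldiv x y) k); first exact: Kd.
by rewrite {1}E -a; congr op; apply/ldivP.
Qed.

End GroupLaw.

Lemma lcoset_repr (X : Type) (op : X -> X -> X) (e : X) (K : set X) :
  exists rep : set X -> X, forall S, lcosets op K S -> lcoset op (rep S) K = S.
Proof.
have /choice [rep repP] : forall S, exists x, lcosets op K S -> lcoset op x K = S.
  move=> S; case: (pselect (lcosets op K S)) => [[x _ <-]|nS]; first by exists x.
  by exists e => /nS.
by exists rep.
Qed.

Lemma zmod_group_law (A : zmodType) : group_law (+%R : A -> A -> A) 0 -%R.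
Proof.
split; [exact: addrA|exact: add0r|exact: addr0|exact: addNr|exact: addrN].
Qed.

Lemma groupType_group_law (G : groupType) :
  group_law (fun x y : G => (x * y)%g) 1%g (fun x => x^-1)%g.
Proof.
split; [exact: mulgA|exact: mul1g|exact: mulg1|exact: mulVg|exact: mulgV].
Qed.

Lemma zmod_subgroupP (A : zmodType) (K : set A) : subgroup +%R 0 K ->
  [/\ K 0, forall x y, K x -> K y -> K (x + y), forall x, K x -> K (- x) &
      forall x y, K x -> K (x + y) -> K y].
Proof.
move=> sK; have [K0 KD _] := sK.
have [_ Kc] := (subgroup_cancelP (zmod_group_law A) K).1 sK.
split=> // x Kx; apply: (Kc x) => //; by rewrite subrr.
Qed.

Lemma subgroup_generated (A : zmodType) (S : set A) :
  subgroup +%R 0 (generated +%R 0 S).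
Proof.
apply/(subgroup_cancelP (zmod_group_law A)); split.
  by move=> K [[]].
move=> x y Hx Hy K [sK SK]; have [_ _ _ Kc] := zmod_subgroupP sK.
by apply: (Kc x); [apply: Hx|apply: Hy].
Qed.

Lemma qproj_eqP (A : zmodType) (K : set A) a a' : subgroup +%R 0 K ->
  qproj K a = qproj K a' <-> K (a - a').
Proof.
move=> sK; have [_ _ KN _] := zmod_subgroupP sK.
rewrite /qproj (lcoset_eqP (zmod_group_law A) _ _ sK) /ldiv addrC.
by split=> /KN; rewrite opprB.
Qed.

                                                  

Section Bounded.
Context (L : language) (N : structure L) (kappa : Type).
Hypothesis small_natnat : small kappa [set: nat -> nat].
Hypothesis satN : saturated kappa N.

Lemma small_nat : small kappa [set: nat].
Proof.
apply: small_le _ small_natnat.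
apply: (@card_le_inj _ _ _ _ (fun n : nat => fun=> n)) => // m n _ _.
by move/(congr1 (fun f => f 0%N)).
Qed.

Context (W : countType) (b : W -> N).
Let C : set N := range b.

Lemma small_params : small kappa C.
Proof.
have s0 : small kappa (@set0 N).
  apply: small_le _ small_nat; exact: card_ge0.
by apply: (small_setU_range small_nat s0 (v := b)); right.
Qed.

Section OneGroup.
Context (V : finType) (X : Type) (c : X -> V -> N) (op : X -> X -> X) (e : X)
  (inv : X -> X).
Hypothesis cc : coded c c.
Hypothesis gX : group_law op e inv.
Hypothesis d_op : definable_fun_over C (pair_code c c) c (fun p => op p.1 p.2).
Let ldv := ldiv op inv.

Lemma definable_fun_over_ldiv : definable_fun_over C (pair_code c c) c (fun p => ldv
    p.1 p.2).
Proof.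
pose r (x : V + V + V) : V + V + V :=
  match x with inl (inl v) => inl (inl v) | inl (inr v) => inr v
             | inr v => inl (inr v) end.
pose k (p : X * X * X) := (p.1.1, p.2, p.1.2).
have H : definable_over C (pair_code (pair_code c c) c)
    [set p | op p.1.1 p.2 = p.1.2].
  by apply: (bidef_ren (r := r) (k := k) (k' := k) _ _ d_op) => p;
    apply: funext => -[[]|].
by apply: (bidef_ext H) => p /=; exact: (ldivP gX).
Qed.

                                                                             
                                        
Lemma shrink K D : type_definable_over C c K -> subgroup op e K -> definable_over C c
    D -> K `<=` D ->
  exists D', [/\ definable_over C c D', K `<=` D' &
    forall x y, D' x -> D' y -> D (ldv x y)].
Proof.
move=> [I [E [dE HK]]] sK dD KD.
have [_ Kd] := (subgroup_ldivP gX K).1 sK.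
suff [s Hs] : exists s : seq I, forall x y,
    (forall i, List.In i s -> E i x) -> (forall i, List.In i s -> E i y) -> D (ldv x y).
  exists [set x | forall i, List.In i s -> E i x]; split=> //.
  - exact: bidef_all_in.
  - by move=> x /HK Kx i _.
apply: contrapT => nex.
pose G i := [set p : X * X | E i p.1 /\ E i p.2].
have dG i : definable_over C (pair_code c c) (G i).
  by apply: bidef_and; [apply: (bidef_ren (r := inl) _ _ (dE i))|
                       apply: (bidef_ren (r := inr) _ _ (dE i))].
have dnD := bidef_not (bidef_comp cc definable_fun_over_ldiv dD).
have [s|[x y] /= nD Gxy] := compactness_in small_nat satN (coded_pair cc cc)
    small_params dnD dG.
  apply: contrapT => np; apply: nex; exists s => x y Ex Ey.
  apply: contrapT => nDxy; apply: np; exists (x, y) => // i si.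
  by split; [exact: Ex|exact: Ey].
by apply/nD/KD/Kd; apply/HK => i; case: (Gxy i).
Qed.

Definition finitely_coloured (D : set X) := exists (T : finType) (chi : X -> T),
  forall x y, chi x = chi y -> D (ldv x y).

                                                                              
                                                                              
                                                                            
                   
Lemma finite_colouring K D : type_definable_over C c K -> subgroup op e K ->
  bounded_index op kappa K -> definable_over C c D -> K `<=` D ->
  finitely_coloured D.
Proof.
move=> tK sK bK dD KD; have [D' [dD' KD' Hd]] := shrink tK sK dD KD.
pose Ix := sig (lcosets op K).
have [rep0 rep0P] := lcoset_repr op e K; pose rep (S : Ix) := rep0 (sval S).
have repP S : lcoset op (rep S) K = sval S by exact/rep0P/svalP.
pose R : set N := (fun p : Ix * V => c (rep p.1) p.2) @` setT.
have sR : small kappa R.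
  apply: small_image.
  pose f (p : Ix * V) := (sval p.1, pickle p.2).
  apply: small_le _ (small_setX_nat small_nat bK).
  apply: (@card_le_inj _ _ _ _ f) => [[[S HS] v] _ //|[[S HS] v] [[S' HS'] v'] _ _ /=].
  case=> E /(pcan_inj pickleK) ->; subst S'.
  by rewrite (Prop_irrelevance HS HS').
pose C' := R `|` C.
have sC' : small kappa C' by exact: (small_setU_range small_nat sR (v := b)).
have CC' : C `<=` C' by right.
pose G (S : Ix) := [set x | ~ D' (ldv (rep S) x)].
have [s Hs] : exists s : seq Ix, forall x, exists2 S, List.In S s & D' (ldv (rep S) x).
  apply: contrapT => nex.
  have [S|s|x Hx] := compactness small_nat satN cc sC' (D := G).
  - apply: bidef_not.
    have cst : definable_fun_over C' c c (fun=> rep S).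
      by apply: definable_fun_over_const => // v; left; exists (S, v).
    have did : definable_fun_over C' c c id by apply: (bifun_ren (r := id) _ _ cc).
    exact: (bidef_comp cc (bifun_comp (coded_pair cc cc) cc (definable_over_sub CC'
        definable_fun_over_ldiv)
      (bifun_pair cst did)) (definable_over_sub CC' dD')).
  - apply: contrapT => np; apply: nex; exists s => x.
    apply: contrapT => nS; apply: np; exists x => S sS DS; apply: nS.
    by exists S.
  - have HS : lcosets op K (lcoset op x K) by exists x.
    apply: (Hx (exist _ _ HS)); apply: KD'.
    by apply/(lcoset_eqP gX _ _ sK); rewrite repP.
pose p x (S : Ix) := `[< D' (ldv (rep S) x) >].
have hp x : has (p x) s.
  have [S + DS] := Hs x; elim: {Hs}(s) => //= S' s' IH [->|/IH ->]; last by rewrite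
      orbT.
  by rewrite (_ : p x S) //; exact/asboolP.
have lt_find x : (find (p x) s < size s)%N by rewrite -has_find.
exists 'I_(size s), (fun x => Ordinal (lt_find x)) => x y /(congr1 val) /= E.
have [S0 _ _] := Hs x.
have /asboolP h1 := nth_find S0 (hp x); have /asboolP h2 := nth_find S0 (hp y).
rewrite E in h1.
by rewrite /ldv -(ldiv_ldiv gX (rep (nth S0 s (find (p y) s)))); exact: Hd.
Qed.

Definition countable_colouring (K : set X) := exists chi : X -> nat -> nat,
  forall x y, chi x = chi y -> K (ldv x y).

                                                                           
Lemma countable_colouring_bounded K : subgroup op e K -> countable_colouring K ->
  bounded_index op kappa K.
Proof.
move=> sK [chi Hchi].
have [rep repP] := lcoset_repr op e K.
apply: small_le _ small_natnat; apply: (@card_le_inj _ _ _ _ (chi \o rep)) => // S S'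
    h h'.
by move=> /Hchi /(lcoset_eqP gX _ _ sK); rewrite !repP.
Qed.

Lemma countable_colouring_setI K K' : countable_colouring K -> countable_colouring K' ->
  countable_colouring (K `&` K').
Proof.
move=> [chi H] [chi' H']; exists (fun x n => pickle (chi x n, chi' x n)) => x y E.
have {}E n : chi x n = chi y n /\ chi' x n = chi' y n.
  by move: (congr1 (fun f => f n) E) => /(pcan_inj pickleK) [].
by split; [apply: H|apply: H']; apply: funext => n; case: (E n).
Qed.

                                                                             
                                                                               
                                            
Lemma countable_refinement K D : type_definable_over C c K -> subgroup op e K ->
  bounded_index op kappa K -> definable_over C c D -> K `<=` D ->
  exists K', [/\ type_definable_over C c K', subgroup op e K', countable_colouring K'
      & K' `<=` D].
Proof.
move=> tK sK bK dD KD.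
pose good := sig (fun D => definable_over C c D /\ K `<=` D).
have /choice [next nextP] : forall E : good, exists E' : good,
    forall x y, sval E' x -> sval E' y -> sval E (ldv x y).
  move=> [E [dE KE]]; have [E' [dE' KE' Hd]] := shrink tK sK dE KE.
  by exists (exist _ E' (conj dE' KE')).
pose D0 : good := exist _ D (conj dD KD).
pose E n := sval (iter n next D0).
have [K1 _] := (subgroup_ldivP gX K).1 sK.
have /choice [chi chiP] : forall n, exists chi : X -> nat,
    forall x y, chi x = chi y -> E n (ldv x y).
  move=> n; have [dE KE] := svalP (iter n next D0).
  have [T [chi H]] := finite_colouring tK sK bK dE KE.
  by exists (pickle \o chi) => x y /(pcan_inj pickleK); exact: H.
exists [set x | forall n, E n x]; split.
- exists nat, E; split=> // n; by case: (svalP (iter n next D0)).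
- apply/(subgroup_ldivP gX); split=> [n|x y Hx Hy n].
    by case: (svalP (iter n next D0)) => _; apply.
  by apply: (nextP (iter n next D0)); [exact: (Hx n.+1)|exact: (Hy n.+1)].
- exists (fun x n => chi n x) => x y Exy n; apply: chiP.
  exact: (congr1 (fun f => f n) Exy).
- by move=> x /(_ 0%N).
Qed.

End OneGroup.

                             

Lemma smallestP T (Q : set (set T)) x :
  smallest Q set0 x <-> forall K, Q K -> K x.
Proof.
split=> [h K QK|h K [QK _]]; last exact: h.
by apply: h; split=> //; exact: sub0set.
Qed.

                                                                              
                                                                            
                                                                               
                                                          
                                                                              
                                         
Lemma conn00_image (V U : finType) (X Y : Type) (c : X -> V -> N) (d : Y -> U -> N)
    (op : X -> X -> X) (e : X) (inv : X -> X)
    (op' : Y -> Y -> Y) (e' : Y) (inv' : Y -> Y) (F : X -> Y) :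
  coded c c -> coded d d -> group_law op e inv -> group_law op' e' inv' ->
  definable_fun_over C (pair_code c c) c (fun p => op p.1 p.2) -> definable_fun_over
      C c d F ->
  (forall x y, F (op x y) = op' (F x) (F y)) -> (forall y, exists x, F x = y) ->
  forall y, conn00 op' e' d kappa b y ->
  exists2 x, conn00 op e c kappa b x & F x = y.
Proof.
move=> cc cd gX gY d_op dF Fop Fsurj y.
move=> /smallestP /= Hy.
pose bdd K := [/\ subgroup op e K, bounded_index op kappa K & type_definable b c K].
pose Ix := {D | definable_over C c D /\ exists2 K, bdd K & K `<=` D}.
have F1 : F e = e'.
  have [_ _ _ vl _] := gY; have [_ l _ _ _] := gX.
  by rewrite -(vl (F e)); apply/esym/(ldivP gY); rewrite -Fop l.
have Fdiv x z : F (ldiv op inv x z) = ldiv op' inv' (F x) (F z).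
  by apply/esym/(ldivP gY); rewrite -Fop; congr F; apply/(ldivP gX).
have sub (s : seq Ix) : exists K, [/\ type_definable_over C c K, subgroup op e K,
    countable_colouring op inv K & forall i, List.In i s -> K `<=` sval i].
  elim: s => [|[D [dD [K [sK bK tK] KD]]] s [K2 [tK2 sK2 kK2 K2s]]].
    by exists setT; split; [exact: type_definable_over_setT|exact: (subgroupT
        gX)|exists (fun _ _ => 0%N)|].
  have tK1 := (type_definable_overP b c K).2 tK.
  have [K' [tK' sK' kK' K'D]] := countable_refinement cc gX d_op tK1 sK bK dD KD.
  exists (K' `&` K2); split.
  - exact: type_definable_over_setI.
  - exact: (subgroupI gX).
  - exact: countable_colouring_setI.
  - by move=> i [<- z [/K'D]//|si z [_ K2z]]; exact: (K2s i).
have fip (s : seq Ix) : exists2 x, forall i, List.In i s -> sval i x & F x = y.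
  have [K [tK sK kK Ks]] := sub s.
  have [x Kx <-] : (F @` K) y; last by exists x => // i si; exact: (Ks i).
  apply: Hy; have sFK : subgroup op' e' (F @` K).
    have [K1 Kd] := (subgroup_ldivP gX K).1 sK; apply/(subgroup_ldivP gY).
    split=> [|_ _ [x Kx <-] [z Kz <-]]; first by exists e.
    by exists (ldiv op inv x z) => //; exact: Kd.
  split=> //; last by apply/type_definable_overP; exact: (type_definable_over_image
      small_nat satN small_params cc).
  have /(small_image (f := fun S => F @` S)) := countable_colouring_bounded gX sK kK.
  apply: small_le; apply: subset_card_le => _ [z _ <-].
  have [x <-] := Fsurj z; exists (lcoset op x K); first by exists x.
  apply/seteqP; split=> [_ [_ [k Kk <-] <-]|_ [_ [k Kk <-] <-]].
    by rewrite Fop; exists (F k) => //; exists k.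
  by exists (op x k) => //; exists k.
pose C' := C `|` range (d y).
have sC' : small kappa C' by exact: (small_setU_range small_nat small_params (v := d
    y)).
have CC' : C `<=` C' by left.
have dF' : definable_fun_over C' c d F := definable_over_sub CC' dF.
have dy : definable_fun_over C' c d (fun=> y) by apply: definable_fun_over_const =>
    // u; right; exists u.
have [i|s|x Fx Hx] := compactness_in small_nat satN cc sC' (bidef_eq cd dF' dy)
    (D := fun i : Ix => sval i).
- by case: i => D [dD ?]; exact: definable_over_sub dD.
- by have [x Hx Fx] := fip s; exists x.
- exists x => //.
  apply/smallestP => K [sK bK tK].
  have /type_definable_overP [J [E [dE HE]]] := tK; apply/HE => j.
  have k : definable_over C c (E j) /\ exists2 K, bdd K & K `<=` E j.
    by split=> //; exists K => // z /HE.
  exact: (Hx (exist _ _ k)).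
Qed.

Lemma type_definable_over_conn00 (V : finType) (X : Type) (c : X -> V -> N) (op : X
    -> X -> X) (e : X) :
  type_definable_over C c (conn00 op e c kappa b).
Proof.
pose Ix := {K | [/\ subgroup op e K, bounded_index op kappa K & type_definable b c K]}.
have := @type_definable_over_bigcap _ _ C _ _ c Ix sval.
case=> [[K bK] /=|I [D [dD HD]]]; first by apply/type_definable_overP; case: bK.
exists I, D; split=> // x; rewrite -HD; split=> [/smallestP h [K bK]|h].
  exact: h.
by apply/smallestP => K bK; exact: (h (exist _ K bK)).
Qed.

Lemma subgroup_conn00 (V : finType) (X : Type) (c : X -> V -> N) op (e : X) inv :
  group_law op e inv -> subgroup op e (conn00 op e c kappa b).
Proof.
move=> gX; apply/(subgroup_ldivP gX); split.
  by apply/smallestP => K [[]].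
move=> x y /smallestP Hx /smallestP Hy; apply/smallestP => K bK.
have [sK _ _] := bK; have [_ Kd] := (subgroup_ldivP gX K).1 sK.
by apply: Kd; [exact: Hx|exact: Hy].
Qed.

                                                                        
                                                                                 
                                
Lemma conn00_compactness (V : finType) (X : Type) (c : X -> V -> N)
    (op : X -> X -> X) (e : X) (inv : X -> X) (C' : set N) J (E : J -> set X) :
  coded c c -> group_law op e inv ->
  definable_fun_over C (pair_code c c) c (fun p => op p.1 p.2) ->
  C `<=` C' -> small kappa C' -> (forall j, definable_over C' c (E j)) ->
  (forall P, definable_over C c P -> finitely_coloured op inv P ->
     exists2 x, P x & forall j, E j x) ->
  exists2 x, conn00 op e c kappa b x & forall j, E j x.
Proof.
move=> cc gX d_op CC' sC' dE HE.
pose bdd K := [/\ subgroup op e K, bounded_index op kappa K & type_definable b c K].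
pose Ix := {D | definable_over C c D /\ exists2 K, bdd K & K `<=` D}.
have col (s : seq Ix) : finitely_coloured op inv [set x | forall i, List.In i s ->
    sval i x].
  elim: s => [|[D [dD [K [sK bK tK] KD]]] s [T [chi Hchi]]].
    by exists unit, (fun=> tt) => x y _ i [].
  have tK1 := (type_definable_overP b c K).2 tK.
  have [T' [chi' Hchi']] := finite_colouring cc gX d_op tK1 sK bK dD KD.
  exists (T' * T)%type, (fun x => (chi' x, chi x)) => x y [/Hchi' h /Hchi h'] i.
  by case=> [<-//|/h'].
pose G (k : Ix + J) := match k with inl i => sval i | inr j => E j end.
have [k|s|x Hx] := compactness small_nat satN cc sC' (D := G).
- by case: k => [[D [dD ?]]|j]; [exact: definable_over_sub dD|exact: dE].
- pose s1 := pmap (fun k : Ix + J => if k is inl i then Some i else None) s.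
  have [|x Px Ex] := HE _ _ (col s1); first by apply: bidef_all_in => -[D []].
  exists x => -[i|j] ks; last exact: Ex.
  by apply: Px; exact: (In_pmap (x := inl i)).
- exists x; last by move=> j; exact: (Hx (inr j)).
  apply/smallestP => K [sK bK tK].
  have /type_definable_overP [I [D [dD HD]]] := tK; apply/HD => i.
  have k : definable_over C c (D i) /\ exists2 K, bdd K & K `<=` D i.
    by split=> //; exists K => // z /HD.
  exact: (Hx (inl (exist _ _ k))).
Qed.

End Bounded.

                                           

Section Extension.
Context (G : groupType) (A : zmodType) (act : G -> A -> A) (h : G -> G -> A).
Hypothesis actP : acts_by_automorphisms act.
Hypothesis hP : cocycle2 act h.

Let act1 a : act 1%g a = a. Proof. by case: actP. Qed.
Let actM g1 g2 a : act (g1 * g2)%g a = act g1 (act g2 a). Proof. by case: actP. Qed.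
Let actD g a1 a2 : act g (a1 + a2) = act g a1 + act g a2. Proof. by case: actP. Qed.

Lemma act0 g : act g 0 = 0.
Proof. by apply: (addrI (act g 0)); rewrite -actD !addr0. Qed.

Lemma actN g a : act g (- a) = - act g a.
Proof. by apply: (addrI (act g a)); rewrite -actD !subrr act0. Qed.

Let h1g g : h 1%g g = 0. Proof. by case: hP => _ /(_ g) []. Qed.
Let hg1 g : h g 1%g = 0. Proof. by case: hP => _ /(_ g) []. Qed.

Definition ext_inv (x : A * G) : A * G :=
  (- act (x.2^-1)%g x.1 - h (x.2^-1)%g x.2, (x.2^-1)%g).

Lemma ext_group_law : group_law (ext_mul act h) (ext_one G A) ext_inv.
Proof.
split.
- move=> [a1 g1] [a2 g2] [a3 g3]; rewrite /ext_mul /= mulgA; congr (_, _).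
  rewrite !actD actM -!addrA; congr (_ + (_ + _)).
  rewrite [RHS]addrCA; congr (_ + _).
  by have [-> _] := hP; rewrite addrC.
- by move=> [a g]; rewrite /ext_mul /= act1 h1g mul1g add0r addr0.
- by move=> [a g]; rewrite /ext_mul /= act0 hg1 mulg1 !addr0.
- move=> [a g]; rewrite /ext_mul /ext_inv /= mulVg; congr (_, _).
  by rewrite -addrA addrACA addNr add0r addNr.
- move=> [a g]; rewrite /ext_mul /ext_inv /= mulgV; congr (_, _).
  rewrite actD !actN -actM mulgV act1 addrA subrr add0r.
  have [/(_ g (g^-1)%g g) + _] := hP.
  by rewrite mulgV mulVg h1g hg1 addr0 add0r => ->; rewrite addNr.
Qed.

Context (K : set A).
Hypothesis sK : subgroup +%R 0 K.
Hypothesis K_act : forall g a, K a -> K (act g a).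

Let K_actV g a : K (act g a) -> K a.
Proof. by move/(K_act (g^-1)%g); rewrite -actM mulVg act1. Qed.

Lemma subgroup_ext_coeff : (forall g1 g2, K (h g1 g2)) ->
  subgroup (ext_mul act h) (ext_one G A) [set x | K x.1].
Proof.
move=> Kh; have [K0 KD KN Kc] := zmod_subgroupP sK.
apply/(subgroup_cancelP ext_group_law); split=> // -[a g] [a' g'] /= Ka.
rewrite -addrA => /(Kc _ _ Ka); rewrite addrC => /(Kc _ _ (Kh _ _)).
exact: K_actV.
Qed.

Lemma subgroup_ext_split (H : set G) (f : G -> A) :
  subgroup (fun x y : G => (x * y)%g) 1%g H -> split_on act h H f ->
  subgroup (ext_mul act h) (ext_one G A) [set x | H x.2 /\ K (x.1 + f x.2)].
Proof.
move=> /(subgroup_cancelP (groupType_group_law G)) [H1 Hc] [f1 hf].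
have [K0 KD KN Kc] := zmod_subgroupP sK.
apply/(subgroup_cancelP ext_group_law); split.
  by split=> //=; rewrite f1 addr0.
move=> [a g] [a' g'] /= [Hg Ka] [Hgg' Kaa']; have Hg' := Hc _ _ Hg Hgg'.
split=> //; apply: (@K_actV g); apply: (Kc _ _ Ka).
suff -> : a + f g + act g (a' + f g') = a + act g a' + h g g' + f (g * g')%g by [].
rewrite hf // actD -[RHS]addrA subrK.
by rewrite addrACA.
Qed.

Lemma bounded_ext_coeff (kappa : Type) (K' : set A) : K' `<=` K ->
  subgroup +%R 0 K' -> bounded_index +%R kappa K' ->
  (forall g1 g2, K (h g1 g2)) ->
  bounded_index (ext_mul act h) kappa [set x : A * G | K x.1].
Proof.
move=> K'K sK' bK' Kh.
have [rep repP] := lcoset_repr +%R 0 K'.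
pose F S := lcoset (ext_mul act h) (rep S, 1%g) [set x : A * G | K x.1].
have sQ := subgroup_ext_coeff Kh.
apply: small_le _ (small_image (f := F) bK').
apply: subset_card_le => _ [[a g] _ <-]; set S := lcoset +%R a K'.
have LS : lcosets +%R K' S by exists a.
exists S => //; apply/(lcoset_eqP ext_group_law _ _ sQ).
have -> : ldiv (ext_mul act h) ext_inv (rep S, 1%g) (a, g) = (- rep S + a, g).
  apply/(ldivP ext_group_law); rewrite /ext_mul /= act1 h1g addr0 mul1g.
  by rewrite addrA subrr add0r.
by apply: K'K; apply/(lcoset_eqP (zmod_group_law A) _ _ sK'); exact: repP.
Qed.

                                                                            
                             
Lemma bounded_ext_split (kappa : Type) (H : set G) (f : G -> A) (t : nat -> G) :
  small kappa [set: nat] -> bounded_index +%R kappa K ->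
  subgroup (fun x y : G => (x * y)%g) 1%g H -> split_on act h H f ->
  (forall g, exists n, exists2 k, H k & (t n * k)%g = g) ->
  bounded_index (ext_mul act h) kappa [set x : A * G | H x.2 /\ K (x.1 + f x.2)].
Proof.
move=> small_nat bK sH hf cover; set T := [set x | _].
have sT : subgroup (ext_mul act h) (ext_one G A) T by exact: subgroup_ext_split.
have [rep repP] := lcoset_repr +%R 0 K.
pose F (p : set A * nat) := lcoset (ext_mul act h) (rep p.1, t p.2) T.
apply: small_le _ (small_image (f := F) (small_setX_nat small_nat bK)).
apply: subset_card_le => _ [[a g] _ <-].
have [n [k Hk Eg]] := cover g.
                                                                           
                
pose a1 := a - h (t n) k + act (t n) (f k).
have LS : lcosets +%R K (lcoset +%R a1 K) by exists a1.
exists (lcoset +%R a1 K, n) => //.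
rewrite /F /=; set r := rep _.
have Kr : K (a1 - r).
  by rewrite addrC; apply/(lcoset_eqP (zmod_group_law A) _ _ sK); exact: repP.
apply/(lcoset_eqP ext_group_law _ _ sT).
have -> : ldiv (ext_mul act h) ext_inv (r, t n) (a, g) =
    (act (t n)^-1%g (a - h (t n) k - r), k).
  apply/(ldivP ext_group_law); rewrite /ext_mul /= Eg -actM mulgV act1.
  by rewrite [r + _]addrC subrK subrK.
split=> //=; apply: (@K_actV (t n)); rewrite actD -actM mulgV act1.
by rewrite addrAC.
Qed.

End Extension.

                        

Section Interpretations.
Context (L : language) (M N : structure L) (iota : M -> N).

Lemma bidef_interpreted0 W (b : W -> M) V X X' (c : X -> V -> M) (c' : X' -> V -> N)
    P P' :
  interpreted0 iota c c' P P' -> bidef b (iota \o b) c c' P P'.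
Proof.
move=> H; apply: (bidef_params (r := of_void W) _ _ H); apply: funext => -[].
Qed.

Lemma coded_interpreted_type V X X' (c : X -> V -> M) (c' : X' -> V -> N) :
  interpreted_type iota c c' -> coded c c'.
Proof.
case=> ic ic' [phi [H H']]; split=> //.
pose r (x : V + void) : V := match x with inl v => v | inr w => of_void V w end.
exists (rename_formula phi r); split=> v.
- rewrite H sat_rename.
  by have -> : join (id v) (of_void M) = v \o r by apply: funext => -[|[]].
- rewrite H' sat_rename.
  by have -> : join (id v) (iota \o of_void M) = v \o r by apply: funext => -[|[]].
Qed.

Hypothesis elem : elementary_embedding iota.

                                                                              
Lemma ext_inclE V X (X' : choiceType) (x0 : X') (c : X -> V -> M) (c' : X' -> V -> N)
    x :
  coded c c' -> c' (ext_incl iota x0 c c' x) = iota \o c x.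
Proof.
move=> [_ _ [phi [H H']]].
have [y _ Ey] : range c' (iota \o c x) by apply/H'; rewrite -elem -H; exists x.
by rewrite /ext_incl; apply: (@xgetPex _ x0 [set y | c' y = iota \o c x]); exists y.
Qed.

Lemma transfer_fun W (b : W -> M) V U X X' Y Y' (c : X -> V -> M) (c' : X' -> V -> N)
    (d : Y -> U -> M) (d' : Y' -> U -> N) F F' x x' y' :
  bifun b (iota \o b) c c' d d' F F' -> c' x' = iota \o c x ->
  d' y' = iota \o d (F x) -> F' x' = y'.
Proof.
move=> dF Ex Ey.
have E : pair_code c' d' (x', y') = iota \o pair_code c d (x, F x).
  by apply: funext => -[v|u]; rewrite /pair_code /= ?Ex ?Ey.
by case: (transfer_at elem dF E) => + _; apply.
Qed.

                                                                                  
Lemma transfer_cover (V : finType) X X' (U : finType) Y Y' (c : X -> V -> M)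
    (c' : X' -> V -> N)
    (d : Y -> U -> M) (d' : Y' -> U -> N) (j : Y -> Y') W (b : W -> M) Q Q' (s : seq
        Y) :
  coded c c' -> coded d d' -> (forall y, d' (j y) = iota \o d y) ->
  bidef b (iota \o b) (pair_code c d) (pair_code c' d') Q Q' ->
  (forall x, exists2 y, List.In y s & Q (x, y)) ->
  forall x', exists2 y, List.In y s & Q' (x', j y).
Proof.
move=> cc dd Ej dQ H x'.
have dQ2 : bidef (@id M) iota (pair_code c d) (pair_code c' d') Q Q'.
  exact: (bidef_params (r := b) _ _ dQ).
have did : bifun (@id M) iota c c' c c' id id by apply: (bifun_ren (r := id) _ _ cc).
have dQy y : bidef (@id M) iota c c' [set x | Q (x, y)] [set x | Q' (x, j y)].
  have cst : bifun (@id M) iota c c' d d' (fun=> y) (fun=> j y).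
    by apply: (@bifun_const _ _ _ _ _ _ _ _ _ _ _ _ _ _ _ _ _ _ (d y)).
  exact: (bidef_comp (coded_pair cc dd) (bifun_pair did cst) dQ2).
have := transfer_all elem (b := id) cc (bidef_not (bidef_all_in s (fun y => bidef_not
    (dQy y)))) _ x'.
move=> /= H'; apply: contrapT => nex; apply: H' => [x|y sy Qy].
  by have [y sy Qy] := H x; move=> /(_ y sy).
by apply: nex; exists y.
Qed.

End Interpretations.

Lemma aut_definable (L : language) (N : structure L) W (b : W -> N) V X (c : X -> V
    -> N)
    (P : set X) s x y :
  automorphism s -> s \o b = b -> c y = s \o c x -> bidef b b c c P P -> P x <-> P y.
Proof.
move=> sA sb E [phi [H _]]; rewrite !H (sat_aut phi (join (c x) b) sA) E.
suff -> : s \o join (c x) b = join (s \o c x) b by [].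
by apply: funext => -[v|w] //=; rewrite -[in RHS]sb.
Qed.

                                                   

                                                                            
                                                                         
             
Lemma sparse_avoid (bad : nat -> nat -> Prop) :
  (forall i m n, bad i m -> bad i n -> (m < n)%N -> (2 ^ i.+1 <= n - m)%N) ->
  forall k x, exists n, (x <= n < x + 2 ^ k)%N /\ forall i, (i < k)%N -> ~ bad i n.
Proof.
move=> gap; elim=> [|k IH] x; first by exists x; rewrite leqnn addn1 ltnSn.
have half y : (forall n, (y <= n < y + 2 ^ k)%N -> ~ bad k n) ->
    exists n, (y <= n < y + 2 ^ k)%N /\ forall i, (i < k.+1)%N -> ~ bad i n.
  move=> nb; have [n [yn Hn]] := IH y; exists n; split=> // i.
  by rewrite ltnS leq_eqVlt => /orP[/eqP->|/Hn//]; exact: nb.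
have e2 : (2 ^ k.+1 = 2 ^ k + 2 ^ k)%N by rewrite expnS mul2n addnn.
case: (pselect (exists2 m, (x <= m < x + 2 ^ k)%N & bad k m)) => [[m xm bm]|nb].
  have [n nx bn|n [/andP[xn nx] Hn]] := half (x + 2 ^ k)%N.
    have mn : (m < n)%N.
      by move: xm nx => /andP[_ mx] /andP[xn _]; exact: leq_trans mx xn.
    have := gap _ _ _ bm bn mn.
    rewrite -(leq_add2l m) (subnKC (ltnW mn)) leqNgt => /negP; apply.
    rewrite e2 addnA.
    move: xm nx => /andP[xm _] /andP[_ nx]; apply: leq_trans nx _.
    by rewrite !leq_add2r.
  exists n; rewrite e2 addnA nx andbT; split=> //.
  exact: leq_trans (leq_addr _ _) xn.
have [n xn bn|n [/andP[xn nx] Hn]] := half x; first by apply: nb; exists n.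
exists n; rewrite xn e2; split=> //.
by apply: leq_trans nx _; rewrite leq_add2l leq_addr.
Qed.

Section Main.
Context (L : language) (M N : structure L) (iota : M -> N) (kappa : Type)
  (monsterN : monster kappa iota)
  (r : nat) (b : 'I_r -> M)
  (G Gs : groupType) (A As : zmodType) (act : G -> A -> A) (acts : Gs -> As -> As)
  (mG mA : nat) (cG : G -> 'I_mG -> M) (cGs : Gs -> 'I_mG -> N)
  (cA : A -> 'I_mA -> M) (cAs : As -> 'I_mA -> N)
  (actP : acts_by_automorphisms act)
  (defG : interpreted_type iota cG cGs)
  (defA : interpreted_type iota cA cAs)
  (def_mul : interpreted0 iota
     (pair_code (pair_code cG cG) cG) (pair_code (pair_code cGs cGs) cGs)
     (graph2 (fun x y : G => (x * y)%g)) (graph2 (fun x y : Gs => (x * y)%g)))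
  (def_add : interpreted0 iota
     (pair_code (pair_code cA cA) cA) (pair_code (pair_code cAs cAs) cAs)
     (graph2 (fun x y : A => x + y)) (graph2 (fun x y : As => x + y)))
  (def_act : interpreted0 iota
     (pair_code (pair_code cG cA) cA) (pair_code (pair_code cGs cAs) cAs)
     (graph2 act) (graph2 acts))
  (h : G -> G -> A) (hs : Gs -> Gs -> As)
  (hP : cocycle2 act h)
  (def_h : interpreted iota b
     (pair_code (pair_code cG cG) cA) (pair_code (pair_code cGs cGs) cAs)
     (graph2 h) (graph2 hs))
  (Im_h_fin : finite_set [set a | exists g1 g2, h g1 g2 = a])
  (Im_h_dcl : forall g1 g2 (i : 'I_mA), dcl b (cA (h g1 g2) i))
  (A1 : set As)
  (A1_subgroup : subgroup +%R 0 A1)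
  (A1_bounded : bounded_index +%R kappa A1)
  (A1_type_def : type_definable (iota \o b) cAs A1)
  (A1_invariant : forall g a, A1 a -> A1 (acts g a))
  (H : set G) (Hs : set Gs)
  (H_subgroup : subgroup *%g 1%g H)
  (H_index : finite_set (lcosets *%g H))
  (def_H : interpreted iota b cG cGs H Hs)
  (f : G -> A) (fs : Gs -> As)
  (def_f : interpreted iota b (pair_code cG cA) (pair_code cGs cAs)
     (graph1 H f) (graph1 Hs fs))
  (h_split : split_on act h H f).

Let Bs := iota \o b.
Let C : set N := range Bs.
Let A0 := generated +%R 0 [set a | exists g1 g2, h g1 g2 = a].
Let inclA : A -> As := ext_incl iota 0 cA cAs.
Let inclG : G -> Gs := ext_incl iota 1%g cG cGs.
Let A0s : set As := inclA @` A0.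

Let elem : elementary_embedding iota. Proof. by case: monsterN. Qed.
Let satN : saturated kappa N. Proof. by case: monsterN. Qed.
Let small_natnat : small kappa [set: nat -> nat].
Proof. by case: monsterN => _ s _ _; exact: small_nat_nat_of s. Qed.
Let snat := small_nat small_natnat.

Let codedG := coded_interpreted_type defG.
Let codedA := coded_interpreted_type defA.
Let codedGs := coded_right codedG.
Let codedAs := coded_right codedA.

Let dmul : bifun b Bs (pair_code cG cG) (pair_code cGs cGs) cG cGs
   (fun p => (p.1 * p.2)%g) (fun p => (p.1 * p.2)%g) := bidef_interpreted0 b def_mul.
Let dadd : bifun b Bs (pair_code cA cA) (pair_code cAs cAs) cA cAs
   (fun p => p.1 + p.2) (fun p => p.1 + p.2) := bidef_interpreted0 b def_add.
Let dact : bifun b Bs (pair_code cG cA) (pair_code cGs cAs) cA cAs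
   (fun p => act p.1 p.2) (fun p => acts p.1 p.2) := bidef_interpreted0 b def_act.
Let dh : bifun b Bs (pair_code cG cG) (pair_code cGs cGs) cA cAs
   (fun p => h p.1 p.2) (fun p => hs p.1 p.2) := def_h.

Local Notation bifun_mul := (bifun2 codedG codedG codedG dmul).
Local Notation bifun_add := (bifun2 codedA codedA codedA dadd).
Local Notation bifun_act := (bifun2 codedG codedA codedA dact).
Local Notation bifun_h := (bifun2 codedG codedG codedA dh).

Let inclGE x : cGs (inclG x) = iota \o cG x. Proof. exact: (ext_inclE elem). Qed.
Let inclAE x : cAs (inclA x) = iota \o cA x. Proof. exact: (ext_inclE elem). Qed.

Let inclGM x y : inclG (x * y)%g = (inclG x * inclG y)%g.
Proof.
apply/esym; apply: (transfer_fun elem (x := (x, y)) (x' := (inclG x, inclG y)) dmul).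
  by rewrite /pair_code /= !inclGE; apply: funext => -[].
exact: inclGE.
Qed.

Let inclAD x y : inclA (x + y) = inclA x + inclA y.
Proof.
apply/esym; apply: (transfer_fun elem (x := (x, y)) (x' := (inclA x, inclA y)) dadd).
  by rewrite /pair_code /= !inclAE; apply: funext => -[].
exact: inclAE.
Qed.

Let inclG1 : inclG 1%g = 1%g.
Proof. by apply: (mulgI (inclG 1%g)); rewrite -inclGM !mulg1. Qed.
Let inclA0 : inclA 0 = 0.
Proof. by apply: (addrI (inclA 0)); rewrite -inclAD !addr0. Qed.
Let inclAN x : inclA (- x) = - inclA x.
Proof. by apply: (addrI (inclA x)); rewrite -inclAD !subrr. Qed.
Let inclGV x : inclG (x^-1)%g = (inclG x)^-1%g.
Proof. by apply: (mulgI (inclG x)); rewrite -inclGM !mulgV. Qed.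
Let inclGX x n : inclG (x ^+ n)%g = (inclG x ^+ n)%g.
Proof. by elim: n => [|n IH]; rewrite ?expg0 // !expgS inclGM IH. Qed.
Let inclAMn x n : inclA (x *+ n) = inclA x *+ n.
Proof. by elim: n => [|n IH]; rewrite ?mulr0n // !mulrS inclAD IH. Qed.

Let incl_h g1 g2 : hs (inclG g1) (inclG g2) = inclA (h g1 g2).
Proof.
apply: (transfer_fun elem (x := (g1, g2)) (x' := (inclG g1, inclG g2)) dh).
  by rewrite /pair_code /= !inclGE; apply: funext => -[].
exact: inclAE.
Qed.

Section Constants.
Context (V : finType) (X X' : Type) (c : X -> V -> M) (c' : X' -> V -> N).

                                                                        
Lemma bifun_one : bifun b Bs c c' cG cGs (fun=> 1%g) (fun=> 1%g).
Proof.
have ds := bifun_snd b Bs c c' codedG.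
apply: (bidef_ext (bidef_eq codedG (bifun_mul ds ds) ds)) => -[x y] /=.
  by split=> [<-|E]; rewrite ?mulg1 //; apply: (mulgI y); rewrite mulg1.
by split=> [<-|E]; rewrite ?mulg1 //; apply: (mulgI y); rewrite mulg1.
Qed.

Lemma bifun_zero : bifun b Bs c c' cA cAs (fun=> 0) (fun=> 0).
Proof.
have ds := bifun_snd b Bs c c' codedA.
apply: (bidef_ext (bidef_eq codedA (bifun_add ds ds) ds)) => -[x y] /=.
  by split=> [<-|E]; rewrite ?addr0 //; apply: (addrI y); rewrite addr0.
by split=> [<-|E]; rewrite ?addr0 //; apply: (addrI y); rewrite addr0.
Qed.

End Constants.

                                                                              
                                                                    
Let fH g := if `[< H g >] then f g else 0.
Let fsH g := if `[< Hs g >] then fs g else 0.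

Let fHE g : H g -> fH g = f g. Proof. by rewrite /fH => /asboolT ->. Qed.
Let fsHE g : Hs g -> fsH g = fs g. Proof. by rewrite /fsH => /asboolT ->. Qed.

Let dH : bidef b Bs cG cGs H Hs := def_H.

Let dfH : bifun b Bs cG cGs cA cAs fH fsH.
Proof.
have H1 : bidef b Bs (pair_code cG cA) (pair_code cGs cAs)
    [set p | H p.1 /\ f p.1 = p.2] [set p | Hs p.1 /\ fs p.1 = p.2] := def_f.
have H2 : bidef b Bs (pair_code cG cA) (pair_code cGs cAs)
    [set p | ~ H p.1] [set p | ~ Hs p.1].
  by apply: bidef_not; apply: (bidef_ren (r := inl) _ _ dH).
have H3 := bidef_eq codedA (bifun_zero (pair_code cG cA) (pair_code cGs cAs))
  (bifun_snd b Bs cG cGs codedA).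
apply: (bidef_ext (bidef_or H1 (bidef_and H2 H3))) => -[x y] /=.
  rewrite /fH; case: asboolP => Hx; split=> [->|[[]|[]]] //; by [left|right].
rewrite /fsH; case: asboolP => Hx; split=> [->|[[]|[]]] //; by [left|right].
Qed.

Let incl_H g : H g -> Hs (inclG g).
Proof. by case: (transfer_at elem dH (inclGE g)). Qed.

Let incl_f g : H g -> fs (inclG g) = inclA (f g).
Proof.
move=> Hg; rewrite -fsHE; last exact: incl_H.
by apply: (transfer_fun elem dfH (inclGE g)); rewrite fHE.
Qed.

Let codedGGG := coded_pair (coded_pair codedG codedG) codedG.
Let x1 : bifun b Bs (pair_code (pair_code cG cG) cG) (pair_code (pair_code cGs cGs) cGs)
  cG cGs (fun p => p.1.1) (fun p => p.1.1).
Proof. by apply: (bifun_ren (r := fun v => inl (inl v)) _ _ codedG). Qed.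
Let x2 : bifun b Bs (pair_code (pair_code cG cG) cG) (pair_code (pair_code cGs cGs) cGs)
  cG cGs (fun p => p.1.2) (fun p => p.1.2).
Proof. by apply: (bifun_ren (r := fun v => inl (inr v)) _ _ codedG). Qed.
Let x3 : bifun b Bs (pair_code (pair_code cG cG) cG) (pair_code (pair_code cGs cGs) cGs)
  cG cGs (fun p => p.2) (fun p => p.2).
Proof. by apply: (bifun_ren (r := inr) _ _ codedG). Qed.

Let idG : bifun b Bs cG cGs cG cGs id id.
Proof. by apply: (bifun_ren (r := id) _ _ codedG). Qed.
Let idA : bifun b Bs cA cAs cA cAs id id.
Proof. by apply: (bifun_ren (r := id) _ _ codedA). Qed.

Let actsP : acts_by_automorphisms acts.
Proof.
case: actP => a1 aM aD; split.
- exact: (transfer_all elem codedA (bidef_eq codedA (bifun_act (bifun_one _ _) idA)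
    idA)).
- have ok := coded_pair (coded_pair codedG codedG) codedA.
  pose c := pair_code (pair_code cG cG) cA; pose c' := pair_code (pair_code cGs cGs)
      cAs.
  have y1 : bifun b Bs c c' cG cGs (fun p => p.1.1) (fun p => p.1.1).
    by apply: (bifun_ren (r := fun v => inl (inl v)) _ _ codedG).
  have y2 : bifun b Bs c c' cG cGs (fun p => p.1.2) (fun p => p.1.2).
    by apply: (bifun_ren (r := fun v => inl (inr v)) _ _ codedG).
  have y3 := bifun_snd b Bs (pair_code cG cG) (pair_code cGs cGs) codedA.
  move=> g1 g2 a.
  have E := bidef_eq codedA (bifun_act (bifun_mul y1 y2) y3)
    (bifun_act y1 (bifun_act y2 y3)).
  by apply: (transfer_all elem ok E _ (g1, g2, a)) => -[[? ?] ?] /=.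
- have ok := coded_pair (coded_pair codedG codedA) codedA.
  pose c := pair_code (pair_code cG cA) cA; pose c' := pair_code (pair_code cGs cAs)
      cAs.
  have y1 : bifun b Bs c c' cG cGs (fun p => p.1.1) (fun p => p.1.1).
    by apply: (bifun_ren (r := fun v => inl (inl v)) _ _ codedG).
  have y2 : bifun b Bs c c' cA cAs (fun p => p.1.2) (fun p => p.1.2).
    by apply: (bifun_ren (r := fun v => inl (inr v)) _ _ codedA).
  have y3 := bifun_snd b Bs (pair_code cG cA) (pair_code cGs cAs) codedA.
  move=> g a1' a2'.
  have E := bidef_eq codedA (bifun_act y1 (bifun_add y2 y3))
    (bifun_add (bifun_act y1 y2) (bifun_act y1 y3)).
  by apply: (transfer_all elem ok E _ (g, a1', a2')) => -[[? ?] ?] /=.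
Qed.

Let hsP : cocycle2 acts hs.
Proof.
case: hP => hc h1; split.
  move=> g1 g2 g3.
  have E := bidef_eq codedA
    (bifun_add (bifun_h x1 x2)
       (bifun_h (bifun_mul x1 x2) x3))
    (bifun_add (bifun_h x1 (bifun_mul x2 x3))
       (bifun_act x1 (bifun_h x2 x3))).
  by apply: (transfer_all elem codedGGG E _ (g1, g2, g3)) => -[[? ?] ?] /=.
move=> g; split.
  apply: (transfer_all elem codedG (bidef_eq codedA (bifun_h idG (bifun_one _ _))
      (bifun_zero _ _)) _ g).
  by move=> x /=; case: (h1 x).
apply: (transfer_all elem codedG (bidef_eq codedA (bifun_h (bifun_one _ _) idG)
    (bifun_zero _ _)) _ g).
by move=> x /=; case: (h1 x).
Qed.

Let codedGG := coded_pair codedG codedG.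
Let z1 := bifun_fst b Bs cG cGs codedG.
Let z2 := bifun_snd b Bs cG cGs codedG.

Let Hs_subgroup : subgroup *%g 1%g Hs.
Proof.
have [H1 Hc] := (subgroup_cancelP (groupType_group_law G) H).1 H_subgroup.
apply/(subgroup_cancelP (groupType_group_law Gs)); split.
  by rewrite -inclG1; exact: incl_H.
move=> x z.
have E := bidef_imp (bidef_comp codedG z1 dH)
  (bidef_imp (bidef_comp codedG (bifun_mul z1 z2) dH) (bidef_comp codedG z2 dH)).
by apply: (transfer_all elem codedGG E _ (x, z)) => -[? ?] /=; exact: Hc.
Qed.

Let hs_split : split_on acts hs Hs fs.
Proof.
have [f1 fh] := h_split; split.
  have H1 : H 1%g by case: H_subgroup.
  by rewrite -inclG1 incl_f // f1 inclA0.
move=> g1 g2 Hg1 Hg2.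
have Hg12 : Hs (g1 * g2)%g by case: Hs_subgroup => _ + _; apply.
have dm := bifun_mul z1 z2.
have E := bidef_imp (bidef_comp codedG z1 dH) (bidef_imp (bidef_comp codedG z2 dH)
  (bidef_eq codedA (bifun_add (bifun_h z1 z2) (bifun_comp codedG codedA dfH dm))
     (bifun_add (bifun_comp codedG codedA dfH z1)
        (bifun_act z1 (bifun_comp codedG codedA dfH z2))))).
have := transfer_all elem codedGG E _ (g1, g2).
rewrite /= !fsHE // => E'.
have {}E' : hs g1 g2 + fs (g1 * g2)%g = fs g1 + acts g1 (fs g2).
  apply: E' => // -[k1 k2] /= Hk1 Hk2.
  have Hk12 : H (k1 * k2)%g by case: H_subgroup => _ + _; apply.
  by rewrite !fHE // fh // subrK.
by rewrite -E' addrK.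
Qed.

                                                                           
                                                                         
Let Hs_cover : exists t : nat -> Gs,
  forall g, exists n, exists2 k, Hs k & (t n * k)%g = g.
Proof.
have [ts Hts] : exists ts : seq G, forall x, exists2 t, List.In t ts &
    exists k, H k /\ (t * k)%g = x.
  have [s Es] := (@finite_seqP {classic (set G)} _).1 H_index.
  have [rep repP] := lcoset_repr *%g 1%g H.
  exists (map rep s) => x; exists (rep (lcoset *%g x H)).
    apply: List.in_map; apply/(@InP {classic (set G)}).
    have : [set` s] (lcoset *%g x H) by rewrite -Es; exists x.
    by [].
  have : lcoset *%g x H x by exists 1%g; [case: H_subgroup|rewrite mulg1].
  rewrite -{1}(repP (lcoset *%g x H)); last by exists x.
  by case=> k Hk E; exists k.
have dQ : bidef b Bs (pair_code cG cG) (pair_code cGs cGs)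
    [set p | exists k, H k /\ (p.2 * k)%g = p.1] [set p | exists k, Hs k /\ (p.2 *
        k)%g = p.1].
  have E := bidef_and (bidef_comp codedG x3 dH)
    (bidef_eq codedG (bifun_mul x2 x3) x1).
  exact: (bidef_ex codedG E).
have cov := transfer_cover elem codedG codedG inclGE dQ Hts.
exists (fun n => nth 1%g (map inclG ts) n) => g.
have [t /(@InP G) tts [k [Hk Ek]]] := cov g.
exists (index t ts), k => //.
by rewrite (nth_map 1%g) ?index_mem // nth_index.
Qed.

                                                                   
Let hs_image : exists s : seq A, (forall g1 g2, h g1 g2 \in s) /\
  forall g1 g2, exists2 a, A0 a & hs g1 g2 = inclA a.
Proof.
have [s Es] := (@finite_seqP A _).1 Im_h_fin.
have hsE g1 g2 : h g1 g2 \in s.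
  by have : [set` s] (h g1 g2) by rewrite -Es; exists g1, g2.
exists s; split=> // g1 g2.
have cov := transfer_cover elem codedGG codedA inclAE dh (s := s).
have [|a /InP sa Ea] := cov _ (g1, g2).
  by move=> [k1 k2]; exists (h k1 k2) => //; exact/InP.
exists a => // K [sK]; apply.
by have : [set` s] a by []; rewrite -Es.
Qed.

Let A0_subgroup : subgroup +%R 0 A0 := subgroup_generated _.

Let A0_ind (K : set A) : subgroup +%R 0 K -> (forall g1 g2, K (h g1 g2)) -> A0 `<=` K.
Proof. by move=> sK Kh a; apply; split=> // _ [g1 [g2 <-]]. Qed.

Let A0s_subgroup : subgroup +%R 0 A0s.
Proof.
have [K0 KD KN Kc] := zmod_subgroupP A0_subgroup.
apply/(subgroup_ldivP (zmod_group_law As)); split; first by exists 0.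
move=> _ _ [x Kx <-] [y Ky <-]; exists (- x + y); first by apply: KD => //; exact: KN.
by rewrite inclAD inclAN.
Qed.

Let A0s_hs g1 g2 : A0s (hs g1 g2).
Proof. by case: hs_image => s [_ /(_ g1 g2) [a Aa ->]]; exists a. Qed.

                                                                                  
Let A0s_act g a : A0s a -> A0s (acts g a).
Proof.
move=> [{}a A0a <-].
have [K0 KD KN Kc] := zmod_subgroupP A0s_subgroup.
have [_ _ actsD] := actsP.
pose K := [set a | A0s (acts g (inclA a))].
suff: K a by [].
apply: (A0_ind _ _ A0a) => [|g2 g3].
  apply/(subgroup_ldivP (zmod_group_law A)); split.
    by rewrite /K /= inclA0 (act0 actsP).
  move=> x y Kx Ky; rewrite /K /ldiv /= inclAD inclAN actsD (actN actsP).
  by apply: KD => //; exact: KN.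
rewrite /K /= -incl_h; have [hc _] := hsP.
by apply: (Kc _ _ (A0s_hs g (inclG g2 * inclG g3)%g)); rewrite -hc; exact: KD.
Qed.

                                                                     
Let A0s_enum : exists e : seq (nat * bool) -> As, forall a, A0s a -> exists w, e w = a.
Proof.
have [s [hsE _]] := hs_image.
pose val (w : seq (nat * bool)) : A :=
  \sum_(p <- w) (if p.2 then - nth 0 s p.1 else nth 0 s p.1).
exists (inclA \o val) => _ [a A0a <-].
suff [w <-] : exists w, val w = a by exists w.
apply: (A0_ind (K := [set a | exists w, val w = a])) A0a => [|g1 g2]; last first.
  exists [:: (index (h g1 g2) s, false)].
  by rewrite /val big_seq1 /= nth_index.
apply/(subgroup_ldivP (zmod_group_law A)); split; first by exists [::]; rewrite /val
    big_nil.
move=> _ _ [w <-] [w' <-].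
exists ([seq (p.1, ~~ p.2) | p <- w] ++ w'); rewrite /val big_cat big_map /=.
congr (_ + _); rewrite -sumrN; apply: eq_bigr => -[i []] _ //=.
by rewrite opprK.
Qed.

Let aut_image s a' : automorphism s -> exists u, cAs u = s \o cAs a'.
Proof.
have [ic ic' [rho [_ Hrho]]] := codedA => sA.
suff [u _ Eu] : range cAs (s \o cAs a') by exists u.
by apply/Hrho; rewrite -sat_aut //; apply/Hrho; exists a'.
Qed.

Let aut_add s x y x' y' z' : automorphism s -> s \o Bs = Bs ->
  cAs x' = s \o cAs x -> cAs y' = s \o cAs y ->
  cAs z' = s \o cAs (x + y) -> x' + y' = z'.
Proof.
move=> sA sB Ex Ey Ez.
have E : pair_code (pair_code cAs cAs) cAs (x', y', z') =
    s \o pair_code (pair_code cAs cAs) cAs (x, y, x + y).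
  by rewrite /pair_code /= Ex Ey Ez; apply: funext => -[[]|].
by case: (aut_definable sA sB E (bidef_right dadd)) => + _; apply.
Qed.

                                                                         
                                                        
Let A0s_fixed s a : automorphism s -> s \o Bs = Bs -> A0s a -> cAs a = s \o cAs a.
Proof.
move=> sA sB [{}a A0a <-].
pose K := [set a | cAs (inclA a) = s \o cAs (inclA a)].
suff: K a by [].
apply: (A0_ind _ _ A0a) => [|g1 g2]; last first.
  apply: funext => i; rewrite /= inclAE /=.
  have [phi Hphi] := Im_h_dcl g1 g2 i.
  set m := cA _ i in Hphi *.
  pose c1 (T : Type) (x : T) (_ : unit) := x.
  have ok1 : coded (@c1 M) (@c1 N) := @coded_single L M N.
  pose P' := [set x : N | sat phi (join (fun _ : unit => x) Bs)].
  have dP : bidef b Bs (@c1 M) (@c1 N) [set m] P' by exists phi.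
  have dP2 : bidef (@id M) iota (@c1 M) (@c1 N) [set m] P'.
    exact: (bidef_params (r := b) _ _ dP).
  have cst : bifun (@id M) iota (@c1 M) (@c1 N) (@c1 M) (@c1 N) (fun=> m) (fun=> iota
      m).
    by apply: (@bifun_const _ _ _ _ _ _ _ _ _ _ _ _ _ _ _ _ _ _ (fun=> m)).
  have idd : bifun (@id M) iota (@c1 M) (@c1 N) (@c1 M) (@c1 N) id id.
    by apply: (bifun_ren (r := id) _ _ ok1).
  have all := transfer_all elem (b := id) ok1 (bidef_iff dP2 (bidef_eq ok1 idd cst))
      (fun x => iff_refl _).
  have Pm : P' (iota m) by apply/all.
  apply/esym; apply/all.
  by apply/(aut_definable (x := iota m) sA sB _ (bidef_right dP)).
have image a' := aut_image a' sA.
have sadd x y x' y' z' := @aut_add s x y x' y' z' sA sB.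
apply/(subgroup_cancelP (zmod_group_law A)); rewrite /K /=; split=> [|x z Kx Kxz].
  rewrite inclA0; have [u Eu] := image 0.
  have Eu2 : cAs u = s \o cAs (0 + 0) by rewrite addr0.
  have u0 : u = 0 by apply: (addrI u); rewrite (sadd _ _ _ _ _ Eu Eu Eu2) addr0.
  by rewrite -Eu u0.
have [u Eu] := image (inclA z); rewrite -Eu; congr cAs.
apply: (addrI (inclA x)); rewrite -inclAD.
by apply/esym/(sadd _ _ _ _ _ Kx Eu); rewrite -inclAD.
Qed.


Lemma definable_over_of V X X' (c : X -> V -> M) (c' : X' -> V -> N) P P' :
  bidef b Bs c c' P P' -> definable_over C c' P'.
Proof. by case=> phi [_ H']; apply/definable_overP; exists phi. Qed.

Let gGs := groupType_group_law Gs.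
Let gT := ext_group_law actsP hsP.
Let codedT := coded_pair codedAs codedGs.
Let cT := pair_code cAs cGs.
Let opT := ext_mul acts hs.
Let oneT := ext_one Gs As.

Let d_opT : definable_fun_over C (pair_code cT cT) cT (fun p => opT p.1 p.2).
Proof.
pose c := pair_code (pair_code cA cG) (pair_code cA cG).
pose c' := pair_code cT cT.
have a1 : bifun b Bs c c' cA cAs (fun p => p.1.1) (fun p => p.1.1).
  by apply: (bifun_ren (r := fun v => inl (inl v)) _ _ codedA).
have g1 : bifun b Bs c c' cG cGs (fun p => p.1.2) (fun p => p.1.2).
  by apply: (bifun_ren (r := fun v => inl (inr v)) _ _ codedG).
have a2 : bifun b Bs c c' cA cAs (fun p => p.2.1) (fun p => p.2.1).
  by apply: (bifun_ren (r := fun v => inr (inl v)) _ _ codedA).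
have g2 : bifun b Bs c c' cG cGs (fun p => p.2.2) (fun p => p.2.2).
  by apply: (bifun_ren (r := fun v => inr (inr v)) _ _ codedG).
apply: (@definable_over_of _ _ _ (pair_code c (pair_code cA cG)) _ [set p | ext_mul
    act h p.1.1 p.1.2 = p.2]).
exact: (bifun_pair
  (bifun_add (bifun_add a1 (bifun_act g1 a2))
     (bifun_h g1 g2))
  (bifun_mul g1 g2)).
Qed.

Let d_mulGs : definable_fun_over C (pair_code cGs cGs) cGs (fun p => (p.1 * p.2)%g)
    := definable_over_of dmul.

Let tA1 : type_definable_over C cAs A1. Proof. exact/type_definable_overP. Qed.

Let T := [set x : As * Gs | Hs x.2 /\ A1 (x.1 + fs x.2)].

Let subgroup_T : subgroup opT oneT T.
Proof. exact: (subgroup_ext_split actsP hsP A1_subgroup A1_invariant Hs_subgroup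
    hs_split). Qed.

Let bounded_T : bounded_index opT kappa T.
Proof.
have [t Ht] := Hs_cover.
exact: (bounded_ext_split actsP hsP A1_subgroup A1_invariant snat A1_bounded
  Hs_subgroup hs_split Ht).
Qed.

Let type_definable_over_T : type_definable Bs cT T.
Proof.
apply/type_definable_overP.
have -> : T = [set x | Hs x.2] `&` [set x | A1 (x.1 + fsH x.2)].
  by apply/seteqP; split=> -[a g] [/= Hg]; rewrite fsHE.
have a1 := bifun_fst b Bs cG cGs codedA; have g1 := bifun_snd b Bs cA cAs codedG.
apply: type_definable_over_setI; first
    exact/type_definable_over_definable/(definable_over_of (bidef_comp codedG g1 dH)).
apply: (type_definable_over_comp codedAs (F := fun x => x.1 + fsH x.2)) tA1.
exact: (definable_over_of (bifun_add a1 (bifun_comp codedG codedA dfH g1))).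
Qed.

Let Q := sumset A0s A1.

Let subgroup_Q : subgroup +%R 0 Q.
Proof.
have [a0 aD aN _] := zmod_subgroupP A0s_subgroup.
have [b0 bD bN _] := zmod_subgroupP A1_subgroup.
apply/(subgroup_ldivP (zmod_group_law As)); split.
  by exists 0 => //; exists 0 => //; rewrite addr0.
move=> _ _ [x Ax [y By <-]] [x' Ax' [y' By' <-]].
exists (- x + x'); first by apply: aD => //; exact: aN.
exists (- y + y'); first by apply: bD => //; exact: bN.
by rewrite /ldiv opprD addrACA.
Qed.

Let Q_act g a : Q a -> Q (acts g a).
Proof.
move=> [x Ax [y By <-]]; have [_ _ actsD] := actsP; rewrite actsD.
by exists (acts g x); [exact: A0s_act|exists (acts g y) => //; exact: A1_invariant].
Qed.

Let Q_hs g1 g2 : Q (hs g1 g2).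
Proof.
have [b0 _ _ _] := zmod_subgroupP A1_subgroup.
by exists (hs g1 g2) => //; exists 0 => //; rewrite addr0.
Qed.

Let A1_Q : A1 `<=` Q.
Proof.
have [a0 _ _ _] := zmod_subgroupP A0s_subgroup.
by move=> a Aa; exists 0 => //; exists a => //; rewrite add0r.
Qed.

Let aut_invariant_Q : aut_invariant Bs cT [set x | Q x.1].
Proof.
move=> s sA sB x y E [u Au [v Av Ex]].
have Ey : cAs y.1 = s \o cAs x.1.
  by apply: funext => i; exact: (congr1 (fun k => k (inl i)) E).
have [v' Ev'] := aut_image v sA.
exists u => //; exists v'; last first.
  by apply: (aut_add sA sB (A0s_fixed sA sB Au) Ev'); rewrite Ex.
have [Phi HPhi] := A1_type_def; apply/HPhi => phi Hphi.
have d : bidef Bs Bs cAs cAs [set a | sat phi (join (cAs a) Bs)]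
  [set a | sat phi (join (cAs a) Bs)] by exists phi.
apply/(aut_definable sA sB Ev' d).
by move/HPhi: Av; apply.
Qed.

Let Gs00 := conn00 *%g 1%g cGs kappa Bs.
Let Gts00 := conn00 opT oneT cT kappa Bs.
Let Gts000 := conn000 opT oneT cT kappa Bs.
Let fbar := qproj A1 \o fs.

Let Gts00_T : Gts00 `<=` T.
Proof. by move=> x /smallestP; apply. Qed.

Let Gts000_Q : Gts000 `<=` [set x | Q x.1].
Proof.
move=> x /smallestP; apply; split=> //.
  exact: (subgroup_ext_coeff actsP hsP subgroup_Q Q_act Q_hs).
exact: (bounded_ext_coeff actsP hsP subgroup_Q Q_act A1_Q A1_subgroup A1_bounded Q_hs).
Qed.

Lemma fbar_sub_of_eq : Gts000 = Gts00 -> fbar @` Gs00 `<=` quotient Q A1.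
Proof.
move=> E _ [g Gg <-].
have dsnd : definable_fun_over C cT cGs snd by exact: (definable_over_of (bifun_snd b
    Bs cA cAs codedG)).
have [||[a g'] Gx /= Eg] := conn00_image small_natnat satN codedT codedGs gT gGs
    d_opT dsnd _ _ Gg.
- by [].
- by move=> y; exists (0, y).
- subst g'; have [/= Hg A1g] := Gts00_T Gx.
  have /= Qa : [set x | Q x.1] (a, g) by apply: Gts000_Q; rewrite E.
  have [_ QD QN Qc] := zmod_subgroupP subgroup_Q.
  by exists (fs g) => //; apply: (Qc a) => //; exact: A1_Q.
Qed.

Let Gs00_Hs : Gs00 `<=` Hs.
Proof.
move=> x /smallestP; apply; split=> //; last first.
  by apply/type_definable_overP; apply: type_definable_over_definable; exact:
      (definable_over_of dH).
have [t Ht] := Hs_cover.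
apply: (small_countable snat (f := fun n => lcoset *%g (t n) Hs)) => _ [g _ <-].
have [n [k Hk E]] := Ht g; exists n => //.
apply/(lcoset_eqP gGs _ _ Hs_subgroup).
by have -> : ldiv *%g (fun x => x^-1)%g (t n) g = k by apply/(ldivP gGs).
Qed.

                                                                              
                                                                               
                   
Lemma A1_gap (W : countType) (b' : W -> N) (a : As) (k : nat) :
  C `<=` range b' -> (forall n i, range b' (cAs (a *+ n) i)) ->
  (forall n, (0 < n)%N -> ~ A1 (a *+ n)) ->
  exists D, [/\ definable_over (range b') cAs D, A1 `<=` D &
    forall x y z n, D x -> D y -> A1 z -> - x + y + z = a *+ n -> (0 < n)%N -> (k <=
        n)%N].
Proof.
move=> CC aC na.
pose U := [set x | forall n, List.In n [seq n <- seq.iota 0 k | (0 < n)%N] -> x <> a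
    *+ n].
have dU : definable_over (range b') cAs U.
  apply: bidef_all_in => n; apply: bidef_not.
  have did : definable_fun_over (range b') cAs cAs id by apply: (bifun_ren (r := id)
      _ _ codedAs).
  exact: (bidef_eq codedAs did (definable_fun_over_const _ codedAs (aC n))).
have UA : A1 `<=` U.
  move=> x Ax n /InP; rewrite mem_filter => /andP[n0 _] E.
  by apply: (na n n0); rewrite -E.
have gA := zmod_group_law As.
have dD := definable_over_sub CC (definable_over_of dadd).
have tA := type_definable_over_sub CC tA1.
have [D1 [dD1 AD1 H1]] := shrink small_natnat satN codedAs gA dD tA A1_subgroup dU UA.
have [D2 [dD2 AD2 H2]] := shrink small_natnat satN codedAs gA dD tA A1_subgroup dD1 AD1.
have [_ _ AN _] := zmod_subgroupP A1_subgroup.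
exists D2; split=> // x y z n Dx Dy Az E n0; rewrite leqNgt; apply/negP => nk.
have := H1 (- z) (- x + y) (AD1 _ (AN _ Az)) (H2 _ _ Dx Dy) n.
rewrite /ldiv opprK addrC E; apply=> //.
by apply/InP; rewrite mem_filter n0 mem_iota.
Qed.

                                                                               
                                                                                 
                              
Lemma not_sub_of_multiples (a : As) : torsion_free_quotient A0s (A1 `&` A0s) ->
  ~ A1 a -> (forall n, exists2 g, Gs00 g & A1 (fs g - a *+ n)) ->
  ~ (fbar @` Gs00 `<=` quotient Q A1).
Proof.
move=> tf nA1a mult sub.
have [A10 A1D A1N A1c] := zmod_subgroupP A1_subgroup.
have A1Mn x n : A1 x -> A1 (x *+ n).
  by move=> Ax; elim: n => [|n IH]; rewrite ?mulr0n // mulrS; exact: A1D.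
have [A00 A0D A0N A0c] := zmod_subgroupP A0s_subgroup.
have A0Mn x n : A0s x -> A0s (x *+ n).
  by move=> Ax; elim: n => [|n IH]; rewrite ?mulr0n // mulrS; exact: A0D.
have Fg g : Gs00 g -> exists2 x, A0s x & A1 (fs g - x).
  move=> Gg; have [|q [x Ax [y Ay <-]] Eq] := sub (fbar g); first by exists g.
  exists x => //; have /(qproj_eqP _ _ A1_subgroup) := esym Eq.
  by rewrite opprD addrA => /A1D /(_ Ay); rewrite subrK.
                                                                           
                                                 
have [a0 A0a0 Aa0] : exists2 x, A0s x & A1 (a - x).
  have [g Gg] := mult 1%N; rewrite mulr1n => A1g.
  have [x Ax Agx] := Fg g Gg; exists x => //.
  by apply: (A1c _ _ A1g); rewrite addrA subrK.
have na n : (0 < n)%N -> ~ A1 (a0 *+ n).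
  move=> n0 An; apply: nA1a.
  have sI : subgroup +%R 0 (A1 `&` A0s).
    by apply: (subgroupI (zmod_group_law As)).
  have := tf a0 n A0a0 n0; rewrite !(qproj_eqP _ _ sI) !subr0 => -[].
    by split=> //; exact: A0Mn.
  by move=> A1a0 _; have := A1D _ _ Aa0 A1a0; rewrite subrK.
have {mult}mult n : exists2 g, Gs00 g & A1 (fs g - a0 *+ n).
  have [g Gg Ag] := mult n; exists g => //.
  have := A1D _ _ Ag (A1Mn _ n Aa0).
  by rewrite mulrnBl addrA subrK.
have [e He] := A0s_enum.
pose word := seq (nat * bool).
pose b' : 'I_r + (nat * 'I_mA) + (word * 'I_mA) -> N :=
  join (join Bs (fun p => cAs (a0 *+ p.1) p.2)) (fun p => cAs (- e p.1) p.2).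
have CC : C `<=` range b' by move=> _ [i _ <-]; exists (inl (inl i)).
have aC n i : range b' (cAs (a0 *+ n) i) by exists (inl (inr (n, i))).
have eC w i : range b' (cAs (- e w) i) by exists (inr (w, i)).
have /choice [D HD] i := A1_gap (2 ^ i.+1) CC aC na.
                                                                             
              
pose bad i n := exists2 w : word, pickle w = i &
  exists2 z, A1 z & D i (a0 *+ n + z - e w).
have gap i m n : bad i m -> bad i n -> (m < n)%N -> (2 ^ i.+1 <= n - m)%N.
  move=> [w Ew [z Az Dz]] [w' Ew' [z' Az' Dz']] mn.
  have {Ew'}E : w' = w by apply: (pcan_inj pickleK); rewrite Ew'.
  rewrite {}E in Dz'; have [_ _ H3] := HD i.
  apply: (H3 _ _ (z - z') _ Dz Dz'); last by rewrite subn_gt0.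
    by apply: A1D => //; exact: A1N.
  rewrite mulrnBr ?(ltnW mn) // [- _ + _]addrC opprB [_ + (e w - _)]addrA subrK opprD
      [_ + (_ - z)]addrACA.
  by rewrite -(opprB z z') subrK.
have [I [E [dE HE]]] := type_definable_over_conn00 kappa Bs cGs *%g 1%g.
pose F (k : I + word) := match k with inl i => E i
  | inr w => [set g | ~ D (pickle w) (fsH g + - e w)] end.
have [k|s|g Hg] := compactness snat satN codedGs (small_params (b := b')
    small_natnat) (D := F).
- case: k => [i|w]; first exact: definable_over_sub (dE i).
  apply: bidef_not; have [dD _ _] := HD (pickle w).
  have dfw := bifun2 codedAs codedAs codedAs (definable_over_sub CC
      (definable_over_of dadd)) (definable_over_sub CC (definable_over_of dfH))
    (definable_fun_over_const _ codedAs (eC w)).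
  exact: (bidef_comp codedAs dfw dD).
- pose ws := pmap (fun k : I + word => if k is inr w then Some w else None) s.
  have [n [_ Hn]] := sparse_avoid gap (\max_(w <- ws) pickle w).+1 0.
  have [g Gg Ag] := mult n; exists g => -[i _|w ks]; first exact: ((HE g).1 Gg i).
  have ws_w : List.In w ws by exact: (In_pmap (x := inr w)).
  move=> Dw; apply: (Hn (pickle w)).
    by rewrite ltnS; apply: leq_bigmax_seq => //; exact/InP.
  exists w => //; exists (fs g - a0 *+ n) => //.
  have -> : a0 *+ n + (fs g - a0 *+ n) = fs g by rewrite addrC subrK.
  by rewrite -(fsHE (Gs00_Hs Gg)).
- have Gg : Gs00 g by apply/HE => i; exact: (Hg (inl i)).
  have [x /He [w Ew] Ax] := Fg g Gg.
  apply: (Hg (inr w)); have [_ AD _] := HD (pickle w); apply: AD.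
  by rewrite fsHE ?Ew //; exact: Gs00_Hs.
Qed.

Lemma multiples_of_subgroup (S : set (set As)) :
  quotient_subgroup A1 S -> S <> [set A1] -> S `<=` fbar @` Gs00 ->
  exists2 a, ~ A1 a & forall n, exists2 g, Gs00 g & A1 (fs g - a *+ n).
Proof.
move=> [SA [S1 SM _]] Sne SG.
have [A10 A1D A1N _] := zmod_subgroupP A1_subgroup.
have qproj0 : qproj A1 0 = A1.
  by apply/seteqP; split=> [_ [k Ak <-]|k Ak]; [rewrite add0r|exists k; rewrite ?add0r].
have qprojD x y : sumset (qproj A1 x) (qproj A1 y) = qproj A1 (x + y).
  apply/seteqP; split=> [_ [_ [k Ak <-] [_ [l Al <-] <-]]|_ [k Ak <-]].
    by exists (k + l); [exact: A1D|rewrite addrACA].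
  exists (x + k); first by exists k.
  by exists y; [exists 0; rewrite ?addr0|rewrite addrAC].
have [s [Ss sn]] : exists s, S s /\ s <> A1.
  apply: contrapT => nex; apply: Sne; apply/seteqP; split=> [s Ss|_ -> //].
  by apply: contrapT => sn; apply: nex; exists s.
have [a _ Ea] := SA _ Ss; exists a.
  move=> Aa; apply: sn; rewrite -Ea -[RHS]qproj0.
  by apply/(qproj_eqP _ _ A1_subgroup); rewrite subr0.
move=> n; have Sn : S (qproj A1 (a *+ n)).
  elim: n => [|n IH]; first by rewrite mulr0n qproj0.
  by rewrite mulrS -qprojD; apply: SM => //; rewrite Ea.
have [g Gg Eg] := SG _ Sn; exists g => //.
by apply/(qproj_eqP _ _ A1_subgroup).
Qed.

Let dinv : bifun b Bs cG cGs cG cGs (fun x => x^-1)%g (fun x => x^-1)%g.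
Proof.
have E := bidef_eq codedG (bifun_mul z1 z2) (bifun_one _ _).
apply: (bidef_ext E) => -[x y] /=; split=> [<-|E'].
- by rewrite mulgV.
- by apply: (mulgI x); rewrite mulgV.
- by rewrite mulgV.
- by apply: (mulgI x); rewrite mulgV.
Qed.

Let dexp n : bifun b Bs cG cGs cG cGs (fun x => x ^+ n)%g (fun x => x ^+ n)%g.
Proof.
elim: n => [|n IH]; first exact: bifun_one.
apply: (bidef_ext (bifun_mul idG IH)) => -[x y] /=; by rewrite expgS.
Qed.

                                                                  
Lemma thick_of_colouring (P : set Gs) (PM : set G) :
  finitely_coloured (fun x y : Gs => (x * y)%g) (fun x => x^-1)%g P ->
  (forall x, PM x <-> P (inclG x) /\ P (inclG x)^-1%g) -> thick PM.
Proof.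
move=> [T' [chi Hchi]] PME; split.
  by move=> x; rewrite !PME inclGV invgK; tauto.
exists #|T'|.+1 => g; pose k i := chi (inclG (g i)).
have [i [j [ij Ek]]] : exists i j, i != j /\ k i = k j.
  apply: contrapT => nex.
  have /leq_card : injective k.
    move=> i j E; apply: contrapT => /eqP ij; apply: nex; by exists i, j.
  by rewrite card_ord ltnn.
have PMij i' j' : k i' = k j' -> PM ((g i')^-1 * g j')%g.
  move=> E; apply/PME; rewrite inclGM inclGV invgM invgK.
  by split; [exact: Hchi|exact: Hchi].
case: (ltngtP i j) => [lt|gt|/val_inj E].
- by exists i, j; split=> //; exact: PMij.
- by exists j, i; split=> //; exact: PMij.
- by rewrite E eqxx in ij.
Qed.

                                                                           
                                                                               
                                                                                
                                                                           
Lemma multiples_of_thick (a : A) : ~ A1 (inclA a) ->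
  (forall P : set G, definable b cG P -> thick P ->
      exists g : G, [/\ P g, H g & forall n : int, f (expgz g n) = a *~ n]) ->
  exists2 a, ~ A1 a & forall n, exists2 g, Gs00 g & A1 (fs g - a *+ n).
Proof.
move=> na Ha; exists (inclA a) => //.
have [A10 _ _ _] := zmod_subgroupP A1_subgroup.
suff [g Gg Hg] : exists2 g, Gs00 g & forall n : nat,
    Hs (g ^+ n)%g /\ fs (g ^+ n)%g = inclA a *+ n.
  move=> n; exists (g ^+ n)%g; last by case: (Hg n) => _ ->; rewrite subrr.
  have [G1 GM _] := subgroup_conn00 kappa Bs cGs gGs.
  by elim: n => [|n IH]; rewrite ?expg0 // expgS; exact: GM.
pose C' := C `|` range (fun p : nat * 'I_mA => cAs (inclA a *+ p.1) p.2).
have CC' : C `<=` C' by left.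
have sC' : small kappa C'.
  exact: (small_setU_range snat (small_params (b := Bs) small_natnat)
    (v := fun p : nat * 'I_mA => cAs (inclA a *+ p.1) p.2)).
pose E (n : nat) := [set g | Hs (g ^+ n)%g /\ fsH (g ^+ n)%g = inclA a *+ n].
have dE n : definable_over C' cGs (E n).
  have HX := definable_over_sub CC' (definable_over_of (bidef_comp codedG (dexp n) dH)).
  have fX := definable_over_sub CC' (definable_over_of (bifun_comp codedG codedA dfH
      (dexp n))).
  apply: (bidef_and HX); apply: (bidef_eq codedAs fX); apply:
      definable_fun_over_const => // i.
  by right; exists (n, i).
have [|g Gg Eg] := conn00_compactness small_natnat satN codedGs gGs d_mulGs CC' sC' dE.
  move=> P dP colP.
  have dP1 : definable_over C cGs [set x | P x /\ P (x^-1)%g].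
    apply: bidef_and => //; exact: (bidef_comp codedGs (definable_over_of dinv) dP).
  have /definable_overP [phi Hphi] := dP1.
  pose PM : set G := [set x | sat phi (join (cG x) b)].
  have dPM : bidef b Bs cG cGs PM [set x | P x /\ P (x^-1)%g] by exists phi.
  have PME x : PM x <-> P (inclG x) /\ P (inclG x)^-1%g.
    exact: (transfer_at elem dPM (inclGE x)).
  have [|g [Pg Hg fg]] := Ha PM _ (thick_of_colouring colP PME); first by exists phi.
  exists (inclG g); first by case/PME: Pg.
  move=> n; have Hgn : H (g ^+ n)%g.
    have [H1 HM _] := H_subgroup.
    by elim: n => [|n IH]; rewrite ?expg0 // expgS; exact: HM.
  rewrite /E /= -inclGX fsHE; last exact: incl_H.
  split; first exact: incl_H.
  by rewrite incl_f // -inclAMn; congr inclA; exact: (fg n).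
exists g => // n; have [Hn fn] := Eg n.
by rewrite -fn fsHE.
Qed.

Lemma connected_components_differ :
  let assumption3 := ~ (fbar @` Gs00 `<=` quotient (sumset A0s A1) A1) in
  let assumption4 := exists S : set (set As),
    [/\ quotient_subgroup A1 S, S <> [set A1] & S `<=` fbar @` Gs00] in
  let assumption5 := exists a : A, ~ A1 (inclA a) /\
    forall P : set G, definable b cG P -> thick P ->
      exists g : G, [/\ P g, H g & forall n : int, f (expgz g n) = a *~ n] in
  torsion_free_quotient A0s (A1 `&` A0s) ->
  (assumption3 -> Gts000 <> Gts00) /\
  (assumption4 \/ assumption5 -> assumption3).
Proof.
move=> a3 a4 a5 tf; split; first by move=> h3 /fbar_sub_of_eq.
have mult : a4 \/ a5 ->
    exists2 a, ~ A1 a & forall n, exists2 g, Gs00 g & A1 (fs g - a *+ n).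
  move=> [[S [qS Sn SG]]|[a [na Ha]]]; first exact: multiples_of_subgroup SG.
  exact: multiples_of_thick Ha.
by move=> /mult [a na Ha]; exact: not_sub_of_multiples Ha.
Qed.

End Main.

Theorem corollary2p6
  (L : language)
                                                                        
  (M N : structure L) (iota : M -> N) (kappa : Type)
  (monsterN : monster kappa iota)
  (r : nat) (b : 'I_r -> M)
                                                                
  (G Gs : groupType) (A As : zmodType) (act : G -> A -> A) (acts : Gs -> As -> As)
  (mG mA : nat) (cG : G -> 'I_mG -> M) (cGs : Gs -> 'I_mG -> N)
  (cA : A -> 'I_mA -> M) (cAs : As -> 'I_mA -> N)
  (actP : acts_by_automorphisms act)
  (defG : interpreted_type iota cG cGs)
  (defA : interpreted_type iota cA cAs)
  (def_mul : interpreted0 iota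
     (pair_code (pair_code cG cG) cG) (pair_code (pair_code cGs cGs) cGs)
     (graph2 (fun x y : G => (x * y)%g)) (graph2 (fun x y : Gs => (x * y)%g)))
  (def_add : interpreted0 iota
     (pair_code (pair_code cA cA) cA) (pair_code (pair_code cAs cAs) cAs)
     (graph2 (fun x y : A => x + y)) (graph2 (fun x y : As => x + y)))
  (def_act : interpreted0 iota
     (pair_code (pair_code cG cA) cA) (pair_code (pair_code cGs cAs) cAs)
     (graph2 act) (graph2 acts))
                     
  (h : G -> G -> A) (hs : Gs -> Gs -> As)
  (hP : cocycle2 act h)
  (def_h : interpreted iota b
     (pair_code (pair_code cG cG) cA) (pair_code (pair_code cGs cGs) cAs)
     (graph2 h) (graph2 hs))
  (Im_h_fin : finite_set [set a | exists g1 g2, h g1 g2 = a])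
  (Im_h_dcl : forall g1 g2 (i : 'I_mA), dcl b (cA (h g1 g2) i))
                                 
  (A1 : set As)
  (A1_subgroup : subgroup +%R 0 A1)
  (A1_bounded : bounded_index +%R kappa A1)
  (A1_type_def : type_definable (iota \o b) cAs A1)
  (A1_invariant : forall g a, A1 a -> A1 (acts g a))
                      
  (H : set G) (Hs : set Gs)
  (H_subgroup : subgroup *%g 1%g H)
  (H_index : finite_set (lcosets *%g H))
  (def_H : interpreted iota b cG cGs H Hs)
                               
  (f : G -> A) (fs : Gs -> As)
  (def_f : interpreted iota b (pair_code cG cA) (pair_code cGs cAs)
     (graph1 H f) (graph1 Hs fs))
  (h_split : split_on act h H f) :
  let Bs := iota \o b in
  let A0 := generated +%R 0 [set a | exists g1 g2, h g1 g2 = a] in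
  let inclA : A -> As := ext_incl iota 0 cA cAs in
  let A0s : set As := inclA @` A0 in
  let Gs00 := conn00 *%g 1%g cGs kappa Bs in
  let Gts00 := conn00 (ext_mul acts hs) (ext_one Gs As)
                 (pair_code cAs cGs) kappa Bs in
  let Gts000 := conn000 (ext_mul acts hs) (ext_one Gs As)
                 (pair_code cAs cGs) kappa Bs in
  let fbar := qproj A1 \o fs in
  let assumption3 := ~ (fbar @` Gs00 `<=` quotient (sumset A0s A1) A1) in
  let assumption4 := exists S : set (set As),
    [/\ quotient_subgroup A1 S, S <> [set A1] & S `<=` fbar @` Gs00] in
  let assumption5 := exists a : A, ~ A1 (inclA a) /\
    forall P : set G, definable b cG P -> thick P ->
      exists g : G, [/\ P g, H g & forall n : int, f (expgz g n) = a *~ n] in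
                      
  torsion_free_quotient A0s (A1 `&` A0s) ->
  (assumption3 -> Gts000 <> Gts00) /\
  (assumption4 \/ assumption5 -> assumption3).
Proof.
move=> Bs A0 inclA A0s Gs00 Gts00 Gts000 fbar.
exact: (connected_components_differ monsterN actP defG defA def_mul def_add
  def_act hP def_h Im_h_fin Im_h_dcl A1_subgroup A1_bounded A1_type_def
  A1_invariant H_subgroup H_index def_H def_f h_split).
Qed.
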